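(* Let $(H,R)$ be a quasitriangular Hopf algebra of Nenciu type with $R=R_{\mathsf z}R_{\boldsymbol\alpha}$ as described in the context, let $V^{\mathbf r}_{\mathbf p},V^{\mathbf s}_{\mathbf q}\in H\text{-mod}$ (with $\mathbf p,\mathbf q\in\mathbb Z_{\mathbf m}$, $\mathbf r,\mathbf s\in\mathbb Z_2^t$), and let $c$ denote the braiding of $H$-mod. Then $$c^2(V^{\mathbf r}_{\mathbf p}\otimes V^{\mathbf s}_{\mathbf q})=V^{\mathbf r}_{\mathbf p}\otimes V^{\mathbf s}_{\mathbf q}$$ if and only if for each entry $Z_l^\pm$, either $\alpha_l=0$ or the corresponding $r_l\neq0$ or $s_l\neq0$. Otherwise, the order of the braiding map $c$ is infinite.
   Context: Nenciu type Hopf algebra: let $s,t\ge1$, $\mathbf m=(m_1,\dots,m_s)\in\mathbb Z_{>0}^s$, $\xi_a=\exp(2\pi i/m_a)$, $\mathbb Z_{\mathbf m}=\prod_a\mathbb Z/m_a\mathbb Z$. For tuples, $\mathbf v\cdot\mathbf w$ is the entrywise product and $\boldsymbol\xi^{\mathbf v}=\prod_a\xi_a^{v_a}$, $\mathbf K^{\mathbf v}=\prod_aK_a^{v_a}$. Let $\mathsf d,\mathsf u$ be integer $t\times s$ matrices with rows $\mathsf d_k,\mathsf u_k$ satisfying $\boldsymbol\xi^{\mathsf d_k\cdot\mathsf u_l}\boldsymbol\xi^{\mathsf d_l\cdot\mathsf u_k}=1$ and $\boldsymbol\xi^{\mathsf d_k\cdot\mathsf u_k}=-1$. $H(\mathbf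 m,t,\mathsf d,\mathsf u)$ is the Hopf algebra over $\mathbb C$ generated by grouplike $K_1,\dots,K_s$ and nilpotent $X_1,\dots,X_t$ with relations $K_a^{m_a}=1$, $K_aK_b=K_bK_a$, $K_aX_k=\xi_a^{d_{ka}}X_kK_a$, $X_k^2=0$, $X_lX_k=\boldsymbol\xi^{\mathsf d_k\cdot\mathsf u_l}X_kX_l$, and $\Delta(X_k)=1\otimes X_k+X_k\otimes\mathbf K^{\mathsf u_k}$, $\epsilon(X_k)=0$, $S(X_k)=-X_k\mathbf K^{-\mathsf u_k}$. Put $\mathbf X^{\mathbf r}=X_1^{r_1}\cdots X_t^{r_t}$. Standing assumptions: the nilpotent generators consist of a (possibly empty) set of generators denoted $X_k$, $k=1,\dots,t_1$, and generators denoted $Z_l^\pm$, $l=1,\dots,t_2$, where $Z_l^+$ and $Z_l^-$ are of opposite type (their rows in $\mathsf d$ and in $\mathsf u$ are negatives of each other modulo $m_a$ in column $a$), all $Z_l^\pm$ pairwise anticommute, and the $X_k$ anticommute with all $Z_l^\pm$ and do not participate in $R_{\boldsymbol\alpha}$. $L_l=\mathbf K^{\mathsf u_l}$ is the grouplike element attached to $Z_l^{+}$ in its coproduct. $H$ has an R-matrix $R=R_{\mathsf z}R_{\boldsymbol\alpha}$ with $R_{\mathsf z}=\frac1{\prod_am_a}\sum_{\mathbf v,\mathbf w\in\mathbb Z_{\mathbf m}}\boldsymbol\xi^{-\mathbf v\cdot\mathbf w}\mathbf K^{\mathbf w}\otimes\mathbf K^{\mathbf v\mathsf z}$ for an integer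 $s\times s$ matrix $\mathsf z$, satisfying $R_{\mathsf z}R_{\mathsf z,21}=1\otimes1$, and $R_{\boldsymbol\alpha}=\exp\big(\sum_{l=1}^{t_2}\alpha_l(Z_l^+\otimes L_lZ_l^--Z_l^-\otimes L_lZ_l^+)\big)$, $\alpha_l\in\mathbb C$. Its monodromy matrix is $M=R_{21}R=\exp\big(2\sum_{l=1}^{t_2}\alpha_l(Z_l^+\otimes L_lZ_l^--Z_l^-\otimes L_lZ_l^+)\big)$. Braiding: $c:V\otimes W\to W\otimes V$, $v\otimes w\mapsto R''w\otimes R'v$; $c^2$ is given by the action of $M$, and $c^2(V\otimes W)=V\otimes W$ means that the double braiding is the identity. Modules: $\omega_{\mathbf p}=\prod_a\frac1{m_a}\sum_{j=0}^{m_a-1}\xi_a^{-jp_a}K_a^j$, and $V^{\mathbf r}_{\mathbf p}$ is the submodule of $H\omega_{\mathbf p}$ (left multiplication) generated by $\mathbf X^{\mathbf r}\omega_{\mathbf p}$. The entries of $\mathbf r$ and $\mathbf s$ are indexed by the nilpotent generators; in the condition, $r_l$ and $s_l$ are the entries of $\mathbf r$ and $\mathbf s$ corresponding to the generator $Z_l^\pm$ in question (a nonzero entry $r_l$ means that this generator acts by zero on $V^{\mathbf r}_{\mathbf p}$, and similarly for $s_l$ and $V^{\mathbf s}_{\mathbf q}$).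
   Formalization: The condition is corrected: for each Z_l^±, α_l=0, or the entry of r at Z_l^± is nonzero, or the entry of s at the opposite generator Z_l^∓ is nonzero; with both entries at the same generator the claim fails, e.g. for r=(1,0), s=(0,1). *)

(* Defs.v *)
From HB Require Import structures.
From mathcomp Require Import all_boot all_order all_algebra falgebra.
From mathcomp Require Import complex.
From mathcomp Require Import classical_sets boolp reals trigo.
Set Implicit Arguments.
Unset Strict Implicit.
Unset Printing Implicit Defensive.
Import Order.TTheory GRing.Theory Num.Theory.
Local Open Scope ring_scope.

(* Tensor product of finite-dimensional spaces, as matrices of coordinates
   in the library's bases vbasis {:V} and vbasis {:W}. *)
Section Tensor.
Variable F : fieldType.

Definition tens (V W : vectType F) : Type := 'M[F]_(\dim {:V}, \dim {:W}).

HB.instance Definition _ (V W : vectType F) :=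
  Vector.copy (tens V W) 'M[F]_(\dim {:V}, \dim {:W}).

Definition tpure (V W : vectType F) (v : V) (w : W) : tens V W :=
  \matrix_(i, j) (coord (vbasis {:V}) i v * coord (vbasis {:W}) j w).

(* For bilinear f, the linear map V (x) W -> U with v (x) w |-> f v w;
   see tliftE. *)
Definition tlift (V W U : vectType F) (f : V -> W -> U) (x : tens V W) : U :=
  \sum_i \sum_j (x i j) *: f (vbasis {:V})`_i (vbasis {:W})`_j.

Definition bilin (V W U : vectType F) (f : V -> W -> U) : Prop :=
  (forall w, linear (fun v => f v w)) /\ (forall v, linear (f v)).

Lemma tpure_bilin (V W : vectType F) : bilin (@tpure V W).
Proof.
split=> [w|v] a x y; apply/matrixP => i j; rewrite !mxE linearP /=.
  by rewrite mulrDl mulrA.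
by rewrite mulrDr !mulrA (mulrC a).
Qed.

Lemma bilin_suml (V W U : vectType F) (f : V -> W -> U) (bf : bilin f)
    (I : finType) (a : I -> F) (v : I -> V) w :
  f (\sum_i a i *: v i) w = \sum_i a i *: f (v i) w.
Proof.
have [lf _] := bf.
have f0 : f 0 w = 0.
  have := lf w (-1) 0 0; rewrite scaler0 addr0 => /eqP.
  by rewrite scaleN1r addNr => /eqP.
have: forall s : seq I, f (\sum_(i <- s) a i *: v i) w
          = \sum_(i <- s) a i *: f (v i) w; last exact.
by elim=> [|i s IH]; rewrite ?big_nil ?f0 // !big_cons lf IH.
Qed.

Lemma bilin_sumr (V W U : vectType F) (f : V -> W -> U) (bf : bilin f)
    (I : finType) (a : I -> F) v (w : I -> W) :
  f v (\sum_i a i *: w i) = \sum_i a i *: f v (w i).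
Proof.
apply: (@bilin_suml W V U (fun w v => f v w)).
by have [f1 f2] := bf; split.
Qed.

Lemma tliftE (V W U : vectType F) (f : V -> W -> U) v w :
  bilin f -> tlift f (tpure v w) = f v w.
Proof.
move=> bf; rewrite [in RHS](coord_vbasis (memvf v)).
rewrite [in RHS](coord_vbasis (memvf w)).
rewrite (bilin_suml bf); apply: eq_bigr => i _.
rewrite (bilin_sumr bf) scaler_sumr; apply: eq_bigr => j _.
by rewrite mxE scalerA.
Qed.

Fact tlift_linear (V W U : vectType F) (f : V -> W -> U) : linear (tlift f).
Proof.
move=> a x y; rewrite /tlift scaler_sumr -big_split; apply: eq_bigr => i _ /=.
rewrite scaler_sumr -big_split; apply: eq_bigr => j _ /=.
by rewrite !mxE scalerDl scalerA.
Qed.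

Lemma tlift_pure (V W : vectType F) (x : tens V W) :
  tlift (@tpure V W) x = x.
Proof.
apply/matrixP => i j; rewrite /tlift summxE (bigD1 i) //= summxE (bigD1 j) //=.
have Fv (T : vectType F) : free (vbasis {:T}).
  exact: basis_free (vbasisP _).
have cE (T : vectType F) (k l : 'I_(\dim {:T})) :
  coord (vbasis {:T}) k (vbasis {:T})`_l = (k == l)%:R.
  by rewrite coord_free //; case: eqVneq.
rewrite !mxE !cE !eqxx !mulr1 !big1 ?addr0 // => [i' /negPf ne|j' /negPf ne].
  rewrite summxE big1 // => j' _.
  by rewrite !mxE !cE (eq_sym i) ne mul0r mulr0.
by rewrite !mxE !cE (eq_sym j) ne !mulr0.
Qed.

Lemma tens_ext (V W U : vectType F) (f g : tens V W -> U) :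
  linear f -> linear g ->
  (forall v w, f (tpure v w) = g (tpure v w)) -> f =1 g.
Proof.
move=> lf lg fg x; rewrite -(tlift_pure x) /tlift.
pose fl : {linear _ -> _} := HB.pack f (GRing.isLinear.Build _ _ _ _ _ lf).
pose gl : {linear _ -> _} := HB.pack g (GRing.isLinear.Build _ _ _ _ _ lg).
rewrite -[f]/(fl : _ -> _) -[g]/(gl : _ -> _) !linear_sum.
apply: eq_bigr => i _; rewrite !linear_sum; apply: eq_bigr => j _.
by rewrite !linearZ /= fg.
Qed.

End Tensor.
Arguments tpure {F V W} v w.
Arguments tlift {F V W U} f x.

Section TensorAlgebra.
Variables (F : fieldType) (A B : falgType F).

Definition tens_mul (x y : tens A B) : tens A B :=
  tlift (fun a b => tlift (fun a' b' => tpure (a * a') (b * b')) y) x.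
Definition tens_one : tens A B := tpure 1 1.

Let pureDl (V W : vectType F) k (v v' : V) (w : W) :
  tpure (k *: v + v') w = k *: tpure v w + tpure v' w.
Proof. exact: (tpure_bilin V W).1. Qed.
Let pureDr (V W : vectType F) k (v : V) (w w' : W) :
  tpure v (k *: w + w') = k *: tpure v w + tpure v w'.
Proof. exact: (tpure_bilin V W).2. Qed.

Let inner_bilin a b : bilin (fun (a' : A) (b' : B) => tpure (a * a') (b * b')).
Proof.
by split=> [b'|a'] k x y; rewrite mulrDr -scalerAr (pureDl, pureDr).
Qed.

Let tlift_comb (V W U : vectType F) (f g h : V -> W -> U) k x :
  (forall v w, f v w = k *: g v w + h v w) ->
  tlift f x = k *: tlift g x + tlift h x.
Proof.
move=> fE; rewrite /tlift scaler_sumr -big_split; apply: eq_bigr => i _ /=.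
rewrite scaler_sumr -big_split; apply: eq_bigr => j _ /=.
by rewrite fE scalerDr !scalerA mulrC.
Qed.

Let outer_bilin (y : tens A B) :
  bilin (fun a b => tlift (fun a' b' => tpure (a * a') (b * b')) y).
Proof.
by split=> [b|a] k u v; apply: tlift_comb => a' b';
  rewrite mulrDl -scalerAl (pureDl, pureDr).
Qed.

Let mul_linl y : linear (tens_mul^~ y).
Proof. exact: tlift_linear. Qed.
Let mul_linr x : linear (tens_mul x).
Proof.
by move=> k y z; apply: tlift_comb => a b; rewrite tlift_linear.
Qed.

Lemma tens_mulE a b a' b' :
  tens_mul (tpure a b) (tpure a' b') = tpure (a * a') (b * b').
Proof. by rewrite /tens_mul tliftE // tliftE. Qed.

Let comp_lin (U V W : lmodType F) (f : V -> W) (g : U -> V) :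
  linear f -> linear g -> linear (f \o g).
Proof. by move=> lf lg k x y /=; rewrite lg lf. Qed.

Fact tens_mulA : associative tens_mul.
Proof.
move=> x y z; move: x; apply: tens_ext => [||a b].
- exact: mul_linl.
- exact: (@comp_lin _ _ _ (tens_mul^~ z) (tens_mul^~ y)).
move: y; apply: tens_ext => [||a' b'].
- exact: (@comp_lin _ _ _ (tens_mul _) (tens_mul^~ z)).
- exact: (@comp_lin _ _ _ (tens_mul^~ z) (tens_mul _)).
move: z; apply: tens_ext => [||a'' b''].
- exact: (@comp_lin _ _ _ (tens_mul _) (tens_mul _)).
- exact: mul_linr.
by rewrite !tens_mulE !mulrA.
Qed.

Let id_lin : linear (fun x : tens A B => x). Proof. by []. Qed.

Fact tens_mul1l : left_id tens_one tens_mul.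
Proof.
by apply: tens_ext => [||a b]; rewrite ?tens_mulE ?mul1r //; exact: mul_linr.
Qed.

Fact tens_mul1r : right_id tens_one tens_mul.
Proof.
by apply: tens_ext => [||a b]; rewrite ?tens_mulE ?mulr1 //; exact: mul_linl.
Qed.

Fact tens_mulDl : left_distributive tens_mul +%R.
Proof. by move=> x y z; have := mul_linl z 1 x y; rewrite !scale1r. Qed.

Fact tens_mulDr : right_distributive tens_mul +%R.
Proof. by move=> x y z; have := mul_linr x 1 y z; rewrite !scale1r. Qed.

Fact tens_one_neq0 : tens_one != 0.
Proof.
have nz (T : falgType F) : exists i, coord (vbasis {:T}) i 1 != 0.
  apply/existsP; apply: contraT => /existsPn c0.
  rewrite -(oner_eq0 T); apply/eqP.
  rewrite (coord_vbasis (memvf 1)) big1 // => i _.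
  by have := c0 i; rewrite negbK => /eqP ->; rewrite scale0r.
have [i ni] := nz A; have [j nj] := nz B.
apply/eqP => /matrixP/(_ i j)/eqP; rewrite !mxE mulf_eq0.
by rewrite (negPf ni) (negPf nj).
Qed.

HB.instance Definition _ := GRing.Zmodule_isNzRing.Build (tens A B)
  tens_mulA tens_mul1l tens_mul1r tens_mulDl tens_mulDr tens_one_neq0.

Fact tens_scalerAl (k : F) (x y : tens A B) : k *: (x * y) = (k *: x) * y.
Proof.
rewrite -[RHS]/(tens_mul (k *: x) y) -[k *: x]addr0 (mul_linl y).
by rewrite -[tens_mul 0 y]/(0 * y) mul0r addr0.
Qed.
HB.instance Definition _ :=
  GRing.Lmodule_isLalgebra.Build F (tens A B) tens_scalerAl.

Fact tens_scalerAr (k : F) (x y : tens A B) : k *: (x * y) = x * (k *: y).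
Proof.
rewrite -[RHS]/(tens_mul x (k *: y)) -[k *: y]addr0 (mul_linr x).
by rewrite -[tens_mul x 0]/(x * 0) mulr0 addr0.
Qed.
HB.instance Definition _ :=
  GRing.Lalgebra_isAlgebra.Build F (tens A B) tens_scalerAr.
HB.instance Definition _ := Algebra_isFalgebra.Build F (tens A B).

End TensorAlgebra.

Section Hopf.
Variable F : fieldType.

Definition tflip (V W : vectType F) : tens V W -> tens W V :=
  tlift (fun v w => tpure w v).

Definition tassoc (A : vectType F) : tens A (tens A A) -> tens (tens A A) A :=
  tlift (fun a => tlift (fun b c => tpure (tpure a b) c)).

Record hopf (H : falgType F) := Hopf {
  comul : {lrmorphism H -> tens H H};
  counit : {lrmorphism H -> F^o};
  antipode : {linear H -> H};
  comulA : forall h,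
    tlift (fun a b => tpure (comul a) b) (comul h)
    = tassoc (tlift (fun a b => tpure a (comul b)) (comul h));
  counitl : forall h, tlift (fun a b => counit a *: b) (comul h) = h;
  counitr : forall h, tlift (fun a b => counit b *: a) (comul h) = h;
  antipodel : forall h,
    tlift (fun a b => antipode a * b) (comul h) = counit h *: 1;
  antipoder : forall h,
    tlift (fun a b => a * antipode b) (comul h) = counit h *: 1 }.

Section Rmatrix.
Variables (H : falgType F) (hH : hopf H).

Definition leg12 : tens H H -> tens (tens H H) H := fun x => tpure x 1.
Definition leg13 : tens H H -> tens (tens H H) H :=
  tlift (fun a b => tpure (tpure a 1) b).
Definition leg23 : tens H H -> tens (tens H H) H :=
  tlift (fun a b => tpure (tpure 1 a) b).

Definition is_Rmatrix (Q : tens H H) : Prop :=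
  [/\ Q \is a GRing.unit,
      forall h, Q * comul hH h = tflip (comul hH h) * Q,
      tlift (fun a b => tpure (comul hH a) b) Q = leg13 Q * leg23 Q &
      tassoc (tlift (fun a b => tpure a (comul hH b)) Q) = leg13 Q * leg12 Q].

End Rmatrix.

Record hmod (H : falgType F) := HMod {
  hmod_car :> vectType F;
  hact : H -> hmod_car -> hmod_car;
  hact_bilin : bilin hact;
  hact1 : forall v, hact 1 v = v;
  hactM : forall g h v, hact (g * h) v = hact g (hact h v) }.

(* v (x) w |-> R'' w (x) R' v *)
Definition braid (H : falgType F) (Q : tens H H) (V W : hmod H)
    (x : tens V W) : tens W V :=
  tlift (fun a b => tlift (fun v w => tpure (hact b w) (hact a v)) x) Q.

Definition double_braid (H : falgType F) (Q : tens H H) (V W : hmod H) :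
    tens V W -> tens V W := fun x => braid Q (braid Q x).
Arguments double_braid {H} Q V W x.

(* Infinite order of the braiding c on V (x) W. The odd powers of c land in
   W (x) V; if V = W, an odd power n with c^n = 1 would give (c^2)^n = 1, so
   only powers of c^2 need to be considered. *)
Definition braid_infinite_order (H : falgType F) (Q : tens H H)
    (V W : hmod H) : Prop :=
  forall n : nat, (0 < n)%N -> ~ (iter n (double_braid Q V W) =1 id).

Section LeftIdeal.
Variables (H : falgType F) (x : H).

Definition left_ideal : {vspace H} := ({:H} * <[x]>)%VS.

Definition left_ideal_act (h : H) (v : subvs_of left_ideal) :
  subvs_of left_ideal := vsproj left_ideal (h * vsval v).

Fact left_ideal_actE h v : vsval (left_ideal_act h v) = h * vsval v.
Proof.
rewrite vsprojK // /left_ideal; have /memv_cosetP[g _ ->] := subvsP v.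
by rewrite mulrA memv_mul ?memvf ?memv_line.
Qed.

Fact left_ideal_act_bilin : bilin left_ideal_act.
Proof.
split=> [v|h] k g g'; rewrite -linearP /=; congr vsproj => /=.
  by rewrite mulrDl scalerAl.
by rewrite mulrDr scalerAr.
Qed.

Fact left_ideal_act1 v : left_ideal_act 1 v = v.
Proof. by apply: val_inj; rewrite /= left_ideal_actE mul1r. Qed.

Fact left_ideal_actM g h v :
  left_ideal_act (g * h) v = left_ideal_act g (left_ideal_act h v).
Proof. by apply: val_inj; rewrite /= !left_ideal_actE mulrA. Qed.

(* H x as a module under left multiplication *)
Definition left_ideal_mod : hmod H :=
  HMod left_ideal_act_bilin left_ideal_act1 left_ideal_actM.

End LeftIdeal.

(* Exponential of a nilpotent x: the exponential series cut at an N with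
   x ^+ N = 0; the value does not depend on the choice of N. Junk value 0 if x
   is not nilpotent. *)
Definition nilexp (A : falgType F) (x : A) : A :=
  \sum_(n < xget 0%N [set N | x ^+ N = 0]) (n`!%:R)^-1 *: x ^+ n.

End Hopf.

Arguments double_braid {F H} Q V W x.
Arguments braid_infinite_order {F H} Q V W.

Section Nenciu.
Variable R : realType.
Local Notation C := (complex R).

(* exp (2 pi i / n) *)
Definition xi (n : nat) : C :=
  (cos (2 * pi / n%:R) +i* sin (2 * pi / n%:R))%C.

Variables (s t : nat) (m : 'I_s -> nat).

Definition Zm : Type := {dffun forall a : 'I_s, 'I_(m a)}.
HB.instance Definition _ := Finite.on Zm.
Definition Zrow (v : Zm) : 'rV[int]_s := \row_a (v a)%:Z.

Definition rowdot (v w : 'rV[int]_s) : 'rV[int]_s := \row_a (v 0 a * w 0 a).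
Definition xipow (v : 'rV[int]_s) : C := \prod_a xi (m a) ^ v 0 a.

Definition nenciu_matrices (d u : 'M[int]_(t, s)) : Prop :=
  (forall k l, xipow (rowdot (row k d) (row l u))
               * xipow (rowdot (row l d) (row k u)) = 1) /\
  (forall k, xipow (rowdot (row k d) (row k u)) = -1).

Definition nenciu_relations (d u : 'M[int]_(t, s)) (A : algType C)
    (K : 'I_s -> A) (X : 'I_t -> A) : Prop :=
  [/\ forall a, K a ^+ m a = 1,
      forall a b, K a * K b = K b * K a,
      forall a k, K a * X k = xi (m a) ^ d k a *: (X k * K a),
      forall k, X k ^+ 2 = 0 &
      forall k l,
        X l * X k = xipow (rowdot (row k d) (row l u)) *: (X k * X l)].

(* H is the algebra with generators K, X and relations nenciu_relations. *)
Definition nenciu_algebra (d u : 'M[int]_(t, s)) (H : algType C)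
    (K : 'I_s -> H) (X : 'I_t -> H) : Prop :=
  [/\ nenciu_relations d u K X,
      forall (B : algType C) (K' : 'I_s -> B) (X' : 'I_t -> B),
        nenciu_relations d u K' X' ->
        exists f : {lrmorphism H -> B},
          (forall a, f (K a) = K' a) /\ (forall k, f (X k) = X' k) &
      forall (B : algType C) (f g : {lrmorphism H -> B}),
        (forall a, f (K a) = g (K a)) -> (forall k, f (X k) = g (X k)) ->
        f =1 g].

Section Elements.
Variables (H : falgType C) (K : 'I_s -> H) (X : 'I_t -> H).

Definition Kpow (v : 'rV[int]_s) : H := \prod_a K a ^ v 0 a.
Definition Xpow (r : 'I_t -> 'Z_2) : H := \prod_k X k ^+ r k.

Definition nenciu_hopf (d u : 'M[int]_(t, s)) (hH : hopf H) : Prop :=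
  [/\ nenciu_algebra d u K X,
      forall a, [/\ comul hH (K a) = tpure (K a) (K a),
                    counit hH (K a) = 1 & antipode hH (K a) = (K a)^-1] &
      forall k, [/\ comul hH (X k)
                    = tpure 1 (X k) + tpure (X k) (Kpow (row k u)),
                    counit hH (X k) = 0 &
                    antipode hH (X k) = - (X k * Kpow (- row k u))]].

Definition omega (p : Zm) : H :=
  \prod_a ((m a)%:R^-1 *:
            \sum_(j < m a) xi (m a) ^ (- (j%:Z * (p a)%:Z)) *: K a ^+ j).

Definition Vmod (r : 'I_t -> 'Z_2) (p : Zm) : hmod H :=
  left_ideal_mod (Xpow r * omega p).

Definition Rz (z : 'M[int]_s) : tens H H :=
  (\prod_a m a)%N%:R^-1 *: \sum_(v : Zm) \sum_(w : Zm)
    xipow (- rowdot (Zrow v) (Zrow w)) *: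
      tpure (Kpow (Zrow w)) (Kpow (Zrow v *m z)).

(* Z (l, true) and Z (l, false) are the positions, among the t nilpotent
   generators, of those called Z_l^+ and Z_l^-. *)
Definition Ralpha (u : 'M[int]_(t, s)) (t2 : nat) (Z : 'I_t2 * bool -> 'I_t)
    (alpha : 'I_t2 -> C) : tens H H :=
  nilexp (\sum_(l < t2) alpha l *:
    (tpure (X (Z (l, true)))
           (Kpow (row (Z (l, true)) u) * X (Z (l, false)))
     - tpure (X (Z (l, false)))
             (Kpow (row (Z (l, true)) u) * X (Z (l, true))))).

(* The generators outside the range of Z are the remaining X_k. *)
Definition opposite_pairs (d u : 'M[int]_(t, s)) (t2 : nat)
    (Z : 'I_t2 * bool -> 'I_t) : Prop :=
  [/\ injective Z,
      forall l a, (d (Z (l, false)) a = - d (Z (l, true)) a %[mod m a])%Z /\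
                  (u (Z (l, false)) a = - u (Z (l, true)) a %[mod m a])%Z,
      forall i j, i != j -> X (Z i) * X (Z j) = - (X (Z j) * X (Z i)) &
      forall k i, k \notin codom Z -> X k * X (Z i) = - (X (Z i) * X k)].

End Elements.

End Nenciu.

(* Main.v *)
Require Import Defs.
From HB Require Import structures.
From mathcomp Require Import all_boot all_order all_algebra falgebra ring.
From mathcomp Require Import complex reals trigo.
Import Order.TTheory GRing.Theory Num.Theory.
Local Open Scope ring_scope.
Set Implicit Arguments.
Unset Strict Implicit.
Unset Printing Implicit Defensive.

(* Let x be the exponent of R_alpha. It is a sum of commuting square-zero
   elements alpha_l Z_l^(+/-) (x) L_l Z_l^(-/+). Applying the quotient map that
   kills all nilpotent generators in one tensor factor to Q Delta = Delta^op Q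
   shows how R_z commutes with X_k (x) 1 and 1 (x) X_k, and applying such maps to
   the second hexagon identity gives L_l^2 = 1 as soon as alpha_l <> 0. It follows
   that R_z x = x_21 R_z, hence Q_21 Q = exp(x)^2. On a module where x acts by 0
   this is the identity. Conversely exp(x)^k = 1 + k x + g x^2 with g commuting
   with x, so a power fixing a vector v forces x v = -(g x / k)(x v) and, x being
   nilpotent, x v = 0. Finally, H acts on the space with basis the subsets of the
   nilpotent generators, X_k adding k to a subset up to a nonzero scalar; this
   model shows that the terms of x with r_l = s_l = 0 act by linearly independent
   vectors on the generator of V (x) W. *)

(** * Maps and actions on tensor products *)

Section TensorMaps.
Variable F : fieldType.
Implicit Types V W U : vectType F.

Lemma tpureDl V W (v v' : V) (w : W) : tpure (v + v') w = tpure v w + tpure v' w.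
Proof. by have := (tpure_bilin V W).1 w 1 v v'; rewrite !scale1r. Qed.

Lemma tpureDr V W (v : V) (w w' : W) : tpure v (w + w') = tpure v w + tpure v w'.
Proof. by have := (tpure_bilin V W).2 v 1 w w'; rewrite !scale1r. Qed.

Lemma tpure0l V W (w : W) : tpure (0 : V) w = 0.
Proof. by apply: (addrI (tpure (0 : V) w)); rewrite -tpureDl !addr0. Qed.

Lemma tpure0r V W (v : V) : tpure v (0 : W) = 0.
Proof. by apply: (addrI (tpure v (0 : W))); rewrite -tpureDr !addr0. Qed.

Lemma tpureZl V W k (v : V) (w : W) : tpure (k *: v) w = k *: tpure v w.
Proof. by have := (tpure_bilin V W).1 w k v 0; rewrite tpure0l !addr0. Qed.

Lemma tpureZr V W k (v : V) (w : W) : tpure v (k *: w) = k *: tpure v w.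
Proof. by have := (tpure_bilin V W).2 v k w 0; rewrite tpure0r !addr0. Qed.

Lemma tpureNl V W (v : V) (w : W) : tpure (- v) w = - tpure v w.
Proof. by rewrite -scaleN1r tpureZl scaleN1r. Qed.

Lemma tpureNr V W (v : V) (w : W) : tpure v (- w) = - tpure v w.
Proof. by rewrite -scaleN1r tpureZr scaleN1r. Qed.

Lemma coord_neq0 V (v : V) : v != 0 -> exists i, coord (vbasis {:V}) i v != 0.
Proof.
move=> v0; apply/existsP; apply: contraNT v0 => /existsPn c0.
rewrite (coord_vbasis (memvf v)) big1 // => i _.
by have /negbNE/eqP-> := c0 i; rewrite scale0r.
Qed.

Lemma tpure_neq0 V W (v : V) (w : W) : v != 0 -> w != 0 -> tpure v w != 0.
Proof.
move=> /coord_neq0[i vi] /coord_neq0[j wj].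
apply/eqP => /matrixP/(_ i j)/eqP; rewrite !mxE mulf_eq0.
by rewrite (negPf vi) (negPf wj).
Qed.

(** [tlift] is linear in the map being lifted as well; this gives linearity of nested [tlift]s in
    their outer variables. *)
Lemma tlift_comb V W U (f g h : V -> W -> U) k x :
  (forall v w, f v w = k *: g v w + h v w) ->
  tlift f x = k *: tlift g x + tlift h x.
Proof.
move=> fE; rewrite /tlift scaler_sumr -big_split; apply: eq_bigr => i _ /=.
rewrite scaler_sumr -big_split; apply: eq_bigr => j _ /=.
by rewrite fE scalerDr !scalerA mulrC.
Qed.

Section Tmap.
Variables V W V' W' : vectType F.
Variables (f : {linear V -> V'}) (g : {linear W -> W'}).

Definition tmap : tens V W -> tens V' W' := tlift (fun a b => tpure (f a) (g b)).

Fact tmap_bilin : bilin (fun a b => tpure (f a) (g b)).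
Proof.
by split=> [b|a] k x y; rewrite linearP (tpureDl, tpureDr) (tpureZl, tpureZr).
Qed.

Lemma tmapE v w : tmap (tpure v w) = tpure (f v) (g w).
Proof. by rewrite /tmap tliftE //; exact: tmap_bilin. Qed.

HB.instance Definition _ := GRing.isLinear.Build F _ _ _ tmap (@tlift_linear _ _ _ _ _).
End Tmap.

Lemma tflipE V W (v : V) (w : W) : tflip (tpure v w) = tpure w v.
Proof.
rewrite /tflip tliftE //.
by split=> [b|a] k x y; rewrite (tpureDl, tpureDr) (tpureZl, tpureZr).
Qed.

HB.instance Definition _ V W :=
  GRing.isLinear.Build F _ _ _ (@tflip F V W) (@tlift_linear _ _ _ _ _).

Lemma linear_comp V W U (f : {linear V -> W}) (g : {linear W -> U}) : linear (g \o f).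
Proof. by move=> k x y; rewrite /= !linearP. Qed.

Lemma tflipK V W : cancel (@tflip F V W) (@tflip F W V).
Proof.
apply: tens_ext => [||v w]; last by rewrite !tflipE.
  exact: linear_comp.
by [].
Qed.

HB.instance Definition _ V :=
  GRing.isLinear.Build F _ _ _ (@tassoc F V) (@tlift_linear _ _ _ _ _).

Lemma tassocE V (a b c : V) : tassoc (tpure a (tpure b c)) = tpure (tpure a b) c.
Proof.
have bf a' : bilin (fun b c : V => tpure (tpure a' b) c).
  by split=> [y|x] k v v'; rewrite ?tpureDr ?tpureZr ?tpureDl ?tpureZl.
rewrite /tassoc tliftE ?tliftE //.
split=> [y|x] k v v'; last exact: tlift_linear.
by apply: tlift_comb => u w; rewrite !tpureDl !tpureZl.
Qed.

Section Algebras.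
Implicit Types A B : falgType F.

Lemma tpureM A B (a a' : A) (b b' : B) :
  tpure a b * tpure a' b' = tpure (a * a') (b * b') :> tens A B.
Proof. exact: tens_mulE. Qed.

Lemma tpure1 A B : tpure 1 1 = 1 :> tens A B. Proof. by []. Qed.

(** Both sides of multiplicativity are linear in each argument, so [tens_ext] reduces it to pure
    tensors, one argument at a time. *)
Lemma tens_monoid_morphism A B (C : falgType F) (phi : {linear tens A B -> C}) :
  phi 1 = 1 ->
  (forall a b a' b', phi (tpure (a * a') (b * b'))
                     = phi (tpure a b) * phi (tpure a' b')) ->
  monoid_morphism phi.
Proof.
move=> phi1 phiM; split=> // x y; move: x.
apply: tens_ext => [k x x'|k x x'|a b].
- by rewrite mulrDl -scalerAl linearP.
- by rewrite linearP mulrDl -scalerAl.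
move: y; apply: tens_ext => [k x x'|k x x'|a' b'].
- by rewrite mulrDr -scalerAr linearP.
- by rewrite linearP mulrDr -scalerAr.
by rewrite tpureM phiM.
Qed.

Section TmapM.
Variables (A B A' B' : falgType F) (f : {lrmorphism A -> A'}) (g : {lrmorphism B -> B'}).

Fact tmap_monoid_morphism : monoid_morphism (tmap f g).
Proof.
apply: (tens_monoid_morphism (phi := tmap f g)) => [|a b a' b'] /=.
  by rewrite -tpure1 tmapE !rmorph1.
by rewrite !tmapE tpureM !rmorphM.
Qed.
HB.instance Definition _ := GRing.isMonoidMorphism.Build _ _ (tmap f g) tmap_monoid_morphism.
End TmapM.

Fact tflip_monoid_morphism A B : monoid_morphism (@tflip F A B).
Proof.
apply: (tens_monoid_morphism (phi := @tflip F A B)) => [|a b a' b'] /=.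
  by rewrite -tpure1 tflipE.
by rewrite !tflipE tpureM.
Qed.
HB.instance Definition _ A B :=
  GRing.isMonoidMorphism.Build _ _ (@tflip F A B) (tflip_monoid_morphism A B).

Fact tassoc_monoid_morphism A : monoid_morphism (@tassoc F A).
Proof.
split=> [|x y]; first by rewrite -!tpure1 tassocE.
move: x; apply: tens_ext => [k x x'|k x x'|a x].
- by rewrite mulrDl -scalerAl linearP.
- by rewrite linearP mulrDl -scalerAl.
move: y; apply: tens_ext => [k v v'|k v v'|a' y].
- by rewrite mulrDr -scalerAr linearP.
- by rewrite linearP mulrDr -scalerAr.
rewrite tpureM; move: x; apply: tens_ext => [k v v'|k v v'|b c].
- by rewrite mulrDl -scalerAl tpureDr tpureZr linearP.
- by rewrite tpureDr tpureZr linearP mulrDl -scalerAl.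
move: y; apply: tens_ext => [k v v'|k v v'|b' c'].
- by rewrite mulrDr -scalerAr tpureDr tpureZr linearP.
- by rewrite tpureDr tpureZr linearP mulrDr -scalerAr.
by rewrite tpureM !tassocE !tpureM.
Qed.
HB.instance Definition _ A :=
  GRing.isMonoidMorphism.Build _ _ (@tassoc F A) (tassoc_monoid_morphism A).

Lemma leg12M A : {morph @leg12 F A : x y / x * y}.
Proof. by move=> x y; rewrite /leg12 tpureM mulr1. Qed.

Lemma leg13E A (a b : A) : leg13 (tpure a b) = tpure (tpure a 1) b.
Proof.
rewrite /leg13 tliftE //.
by split=> [y|x] k v v'; rewrite ?tpureDr ?tpureZr ?tpureDl ?tpureZl.
Qed.

HB.instance Definition _ A :=
  GRing.isLinear.Build F _ _ _ (@leg13 F A) (@tlift_linear _ _ _ _ _).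

End Algebras.

(** * The factorwise action of H (x) H on a tensor product of modules *)

Section Action.
Variables (H : falgType F) (V W : hmod H).

Definition tact (y : tens H H) (x : tens V W) : tens V W :=
  tlift (fun a b => tlift (fun v w => tpure (hact a v) (hact b w)) x) y.

Lemma hactDl (U : hmod H) (g h : H) k (v : U) : hact (k *: g + h) v = k *: hact g v + hact h v.
Proof. exact: (hact_bilin U).1. Qed.

Lemma hactDr (U : hmod H) (g : H) k (v w : U) :
  hact g (k *: v + w) = k *: hact g v + hact g w.
Proof. exact: (hact_bilin U).2. Qed.

Lemma tact_linl x : linear (tact^~ x).
Proof. exact: tlift_linear. Qed.

Lemma tact_linr y : linear (tact y).
Proof. by move=> k x x'; apply: tlift_comb => a b; rewrite tlift_linear. Qed.

Fact hact_bilin2 (U U' : hmod H) a b :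
  bilin (fun (v : U) (w : U') => tpure (hact a v) (hact b w)).
Proof. by split=> [w|v] k x y; rewrite hactDr (tpureDl, tpureDr) (tpureZl, tpureZr). Qed.

Lemma tactE a b v w : tact (tpure a b) (tpure v w) = tpure (hact a v) (hact b w).
Proof.
rewrite /tact tliftE ?tliftE //; first exact: hact_bilin2.
by split=> [b'|a'] k x y; apply: tlift_comb => v' w';
  rewrite hactDl (tpureDl, tpureDr) (tpureZl, tpureZr).
Qed.

Lemma tactM y y' x : tact (y * y') x = tact y (tact y' x).
Proof.
move: x; apply: tens_ext => [||v w]; first exact: tact_linr.
  by move=> k x x'; rewrite !tact_linr.
move: y; apply: tens_ext => [k z z'||a b].
- by rewrite mulrDl -scalerAl tact_linl.
- exact: tact_linl.
move: y'; apply: tens_ext => [k z z'|k z z'|a' b'].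
- by rewrite mulrDr -scalerAr tact_linl.
- by rewrite tact_linl tact_linr.
by rewrite tpureM !tactE !hactM.
Qed.

Lemma tact1 x : tact 1 x = x.
Proof.
move: x; apply: tens_ext => // [|v w]; first exact: tact_linr.
by rewrite -tpure1 tactE !hact1.
Qed.

Lemma tactD y y' x : tact (y + y') x = tact y x + tact y' x.
Proof. by have := tact_linl x 1 y y'; rewrite !scale1r. Qed.

Lemma tact0l x : tact 0 x = 0.
Proof. by apply: (addrI (tact 0 x)); rewrite -tactD !addr0. Qed.

Lemma tact0r y : tact y 0 = 0.
Proof. by have := tact_linr y (-1) 0 0; rewrite scaler0 addr0 scaleN1r addNr. Qed.

Lemma tactZ k y x : tact (k *: y) x = k *: tact y x.
Proof. by have := tact_linl x k y 0; rewrite tact0l !addr0. Qed.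

Lemma tact_suml (I : finType) (P : pred I) (G : I -> tens H H) x :
  tact (\sum_(i | P i) G i) x = \sum_(i | P i) tact (G i) x.
Proof.
by apply: (big_morph (tact^~ x) (fun y y' => tactD y y' x)); exact: tact0l.
Qed.

Lemma tact_vanish a b x :
  (forall v : V, hact a v = 0) \/ (forall w : W, hact b w = 0) ->
  tact (tpure a b) x = 0.
Proof.
have lin0 : linear (fun _ : tens V W => 0 : tens V W) by move=> k y y'; rewrite scaler0 addr0.
move=> ab0; move: x; apply: tens_ext => // [|v w]; first exact: tact_linr.
by rewrite tactE; case: ab0 => ->; rewrite ?tpure0l ?tpure0r.
Qed.

End Action.

Lemma double_braidE (H : falgType F) (Q : tens H H) (V W : hmod H) (x : tens V W) :
  double_braid Q V W x = tact (tflip Q * Q) x.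
Proof.
have braid_linl (V' W' : hmod H) y : linear (fun q : tens H H => @braid F H q V' W' y).
  exact: tlift_linear.
have braid_linr (V' W' : hmod H) q : linear (@braid F H q V' W').
  by move=> k y y'; apply: tlift_comb => a b; rewrite tlift_linear.
have braidE (V' W' : hmod H) a b (v : V') (w : W') :
    braid (tpure a b) (tpure v w) = tpure (hact b w) (hact a v).
  rewrite /braid tliftE ?tliftE //.
    by split=> [w'|v'] k z z'; rewrite hactDr (tpureDl, tpureDr) (tpureZl, tpureZr).
  by split=> [b'|a'] k z z'; apply: tlift_comb => v' w';
    rewrite hactDl (tpureDl, tpureDr) (tpureZl, tpureZr).
(* The two occurrences of Q are made independent: the identity becomes linear in each and can be
   checked on pure tensors. *)
suff braid2 Q1 Q2 : braid Q1 (braid Q2 x) = tact (tflip Q1 * Q2) x by exact: braid2.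
move: x; apply: tens_ext => [k x x'|k x x'|v w]; rewrite ?tact_linr ?braid_linr //.
move: Q1; apply: tens_ext => [k x x'|k x x'|a b].
- by rewrite braid_linl.
- by rewrite linearP mulrDl -scalerAl tact_linl.
move: Q2; apply: tens_ext => [k x x'|k x x'|a' b'].
- by rewrite braid_linl braid_linr.
- by rewrite mulrDr -scalerAr tact_linl.
by rewrite tflipE tpureM tactE !braidE !hactM.
Qed.

End TensorMaps.

(** * Nilpotent elements and exponentials *)

Section Nilpotent.
Variables (F : fieldType).
Implicit Types A B : falgType F.

Definition nilpotent A (x : A) : Prop := exists N, x ^+ N = 0.

Lemma expr_eq0_le A (x : A) N n : x ^+ N = 0 -> (N <= n)%N -> x ^+ n = 0.
Proof. by move=> xN Nn; rewrite -(subnKC Nn) exprD xN mul0r. Qed.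

(** In each binomial term of exponent N + M, either y occurs at least M times or x at least N
    times. *)
Lemma nilpotentD A (x y : A) :
  GRing.comm x y -> nilpotent x -> nilpotent y -> nilpotent (x + y).
Proof.
move=> cxy [N xN] [M yM]; exists (N + M)%N.
rewrite exprDn_comm // big1 // => i _.
have [iM|Mi] := leqP M i; first by rewrite (expr_eq0_le yM) ?mulr0 ?mul0rn.
rewrite (expr_eq0_le xN) ?mul0r ?mul0rn // leq_subRL; last first.
  by rewrite ltnW // (leq_trans Mi) ?leq_addl.
by rewrite addnC leq_add2l ltnW.
Qed.

Lemma nilpotent_sum A (I : Type) (s : seq I) (G : I -> A) :
  (forall i j, GRing.comm (G i) (G j)) -> (forall i, nilpotent (G i)) ->
  nilpotent (\sum_(i <- s) G i).
Proof.
move=> cG nG; elim: s => [|i s IH]; first by exists 1%N; rewrite big_nil expr1.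
rewrite big_cons; apply: nilpotentD => //.
by apply: commr_sum => j _; apply: cG.
Qed.

Lemma nilpotentZ A (x : A) k : nilpotent x -> nilpotent (k *: x).
Proof. by case=> N xN; exists N; rewrite exprZn xN scaler0. Qed.

(** Replaces the chosen cut-off by any valid one: both sums are extended by zero terms to the larger
    of the two lengths. *)
Lemma nilexpE A (x : A) N : x ^+ N = 0 ->
  nilexp x = \sum_(n < N) (n`!%:R)^-1 *: x ^+ n.
Proof.
move=> xN; rewrite /nilexp; case: classical_sets.xgetP => [N0 _ /= xN0|/(_ N)]; last by [].
rewrite -!(big_mkord predT (fun n => (n`!%:R)^-1 *: x ^+ n)).
have pad M M' : x ^+ M = 0 -> (M <= M')%N ->
   \sum_(0 <= n < M') (n`!%:R)^-1 *: x ^+ n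
   = \sum_(0 <= n < M) (n`!%:R)^-1 *: x ^+ n.
  move=> xM MM'; rewrite (big_cat_nat (leq0n M) MM') //= [X in _ + X]big_nat [X in _ + X]big1 ?addr0 //.
  by move=> n /andP[Mn _]; rewrite (expr_eq0_le xM) ?scaler0.
by rewrite -(pad _ _ xN (leq_maxr N0 N)) (pad _ _ xN0 (leq_maxl N0 N)).
Qed.

Lemma nilexp_morph A B (f : {lrmorphism A -> B}) (x : A) :
  nilpotent x -> f (nilexp x) = nilexp (f x).
Proof.
move=> [N xN]; rewrite (nilexpE xN) (nilexpE (N := N)) -?rmorphXn ?xN ?rmorph0 //.
by rewrite linear_sum; apply: eq_bigr => n _; rewrite linearZ /= rmorphXn.
Qed.

Lemma nilpotent_morph A B (f : {lrmorphism A -> B}) (x : A) : nilpotent x -> nilpotent (f x).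
Proof. by case=> N xN; exists N; rewrite -rmorphXn xN rmorph0. Qed.

Lemma nilexp_intertwine A (x y g : A) : nilpotent x -> nilpotent y ->
  g * x = y * g -> g * nilexp x = nilexp y * g.
Proof.
move=> [N xN] [M yM] gxy; set L := maxn N M.
rewrite (nilexpE (expr_eq0_le xN (leq_maxl N M))).
rewrite (nilexpE (expr_eq0_le yM (leq_maxr N M))).
rewrite big_distrr big_distrl /=; apply: eq_bigr => n _.
rewrite -scalerAr -scalerAl; congr (_ *: _).
elim: (n : nat) => [|k IH]; first by rewrite !expr0 mulr1 mul1r.
by rewrite exprSr mulrA IH -mulrA gxy mulrA -exprSr.
Qed.

Lemma nilexp_sq0 A (x : A) : x ^+ 2 = 0 -> nilexp x = 1 + x.
Proof.
move=> x2; rewrite (nilexpE x2) big_ord_recl big_ord_recl big_ord0 /=.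
by rewrite /bump /= expr0 expr1 !invr1 !scale1r addr0.
Qed.

(** Here g is the sum of the x^n / (n+2)!. Cutting the series at 2 + N ensures that the terms 1 and
    x can be split off. *)
Lemma nilexp_tail A (x : A) : nilpotent x ->
  exists2 g, GRing.comm g x & nilexp x = 1 + x + g * x ^+ 2.
Proof.
move=> [N xN]; have xN2 := expr_eq0_le xN (leq_addl 2 N).
exists (\sum_(n < N) ((n.+2)`!%:R)^-1 *: x ^+ n).
  apply/commr_sym/commr_sum => i _; rewrite /GRing.comm -scalerAr -scalerAl.
  by rewrite -exprS -exprSr.
rewrite (nilexpE xN2) !big_ord_recl /= /bump /= expr0 expr1 !invr1 !scale1r addrA.
congr (_ + _); rewrite big_distrl; apply: eq_bigr => n _ /=.
by rewrite -scalerAl -exprD addn2.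
Qed.

Lemma nilexp_powers A (x : A) k : nilpotent x ->
  exists2 g, GRing.comm g x & nilexp x ^+ k = 1 + x *+ k + g * x ^+ 2.
Proof.
move=> nx; have [g cgx ->] := nilexp_tail nx.
elim: k => [|k [h chx IH]].
  exists 0; first exact: commr_sym (commr0 _).
  by rewrite mulr0n mul0r !addr0.
(* The exponential is 1 + a x with a = 1 + g x. Multiplying 1 + k x + h x^2 by it and collecting
   multiples of x^2 gives the next witness g + h + k a + h a x. *)
have [a aE cax] : exists2 a, a = 1 + g * x & GRing.comm a x.
  exists (1 + g * x) => //.
  by apply/commr_sym/commrD; [apply: commr1 | apply: commrM => //; exact: commr_sym].
exists (g + h + a *+ k + h * a * x).
  apply/commr_sym; do ![apply: commrD]; rewrite ?mulrnA; do ?exact: commr_sym.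
    by apply: commrMn; exact: commr_sym.
  by apply: commrM => //; apply: commrM; exact: commr_sym.
rewrite exprSr IH; have -> : 1 + x + g * x ^+ 2 = 1 + a * x by rewrite aE mulrDl mul1r -mulrA addrA.
rewrite !mulrDl !mulrDr !mulr1 !mul1r.
have -> : x *+ k * (a * x) = a *+ k * x ^+ 2.
  by rewrite !mulrnAl mulrA -cax -mulrA.
have -> : h * x ^+ 2 * (a * x) = h * a * x * x ^+ 2.
  by rewrite mulrA -(mulrA h) -(commrX 2 cax) -!mulrA.
rewrite mulrSr.
rewrite -!addrA; congr (1 + _).
rewrite addrCA; congr (_ + _).
have -> : a * x = x + g * x ^+ 2 by rewrite aE mulrDl mul1r -mulrA.
by rewrite -addrA; congr (_ + (_ + _)); rewrite addrCA.
Qed.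

End Nilpotent.

(** * The subset model of a skew presentation *)

Section RootsOfUnity.
Variable R : realType.
Local Notation C := (complex R).

Lemma xi_exprE n k : xi R n ^+ k
  = (cos (k%:R * (2 * pi / n%:R)) +i* sin (k%:R * (2 * pi / n%:R)))%C.
Proof.
rewrite /xi; move: (2 * pi / n%:R) => th.
elim: k => [|k IH]; first by rewrite mul0r cos0 sin0 expr0.
rewrite exprSr IH -natr1 mulrDl mul1r cosD sinD; apply/eqP.
by rewrite eq_complex /= eqxx addrC eqxx.
Qed.

Lemma xi_expr n : (0 < n)%N -> xi R n ^+ n = 1.
Proof.
move=> n0; rewrite xi_exprE mulrC divfK ?pnatr_eq0 ?lt0n_neq0 //.
by rewrite mulr_natl cos2pi sin2pi.
Qed.

Lemma xi_neq0 n : (0 < n)%N -> xi R n != 0.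
Proof.
move=> n0; apply/eqP => xi0; have := xi_expr n0.
by rewrite xi0 expr0n gtn_eqF // => /esym/eqP; rewrite oner_eq0.
Qed.

Lemma xi_exprz n (k : int) : (0 < n)%N -> (xi R n ^ k) ^+ n = 1.
Proof. by move=> n0; rewrite exprnP exprz_exp mulrC -exprz_exp -exprnP xi_expr // exp1rz. Qed.

End RootsOfUnity.

(** Associativity stated with the ring product of square matrices, so that products of images of
    algebra elements act on columns. *)
Lemma mulmx_act (F : fieldType) n (A B : 'M[F]_n.+1) (v : 'cV[F]_n.+1) :
  (A * B) *m v = A *m (B *m v).
Proof. by rewrite mulmxA. Qed.

(** * Monomial matrices on a basis indexed by a finite set *)

Section Monomial.
Variables (F : fieldType) (T : eqType) (n : nat).
Variables (rk : T -> 'I_n.+1) (vl : 'I_n.+1 -> T).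
Hypotheses (rkK : cancel rk vl) (vlK : cancel vl rk).

Definition mono_vec (x : T) : 'cV[F]_n.+1 := delta_mx (rk x) 0.

Lemma mono_vecE x y : mono_vec x (rk y) 0 = (y == x)%:R.
Proof. by rewrite mxE eqxx andbT (can_eq rkK). Qed.

Definition mono_mx (c : T -> F) (g : T -> T) : 'M[F]_n.+1 :=
  \matrix_(i, j) (c (vl j) * (i == rk (g (vl j)))%:R).

Lemma mono_mxE c g x : mono_mx c g *m mono_vec x = c x *: mono_vec (g x).
Proof.
rewrite -colE; apply/matrixP => i j.
by rewrite !mxE rkK (ord1 j) eqxx andbT.
Qed.

Lemma mono_ext (A B : 'M[F]_n.+1) :
  (forall x, A *m mono_vec x = B *m mono_vec x) -> A = B.
Proof.
move=> AB; apply/matrixP => i j.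
by have /matrixP/(_ i 0) := AB (vl j); rewrite -!colE !mxE vlK.
Qed.
End Monomial.

Section Presentation.
Variables (F : fieldType) (s t : nat).
Variables (m : 'I_s -> nat) (w : 'I_s -> 'I_t -> F) (b : 'I_t -> 'I_t -> F).

(* w a k and b k l play the roles of xi_a ^ d_ka and xi ^ (d_k . u_l). *)
Definition skew_relations (A : algType F) (K : 'I_s -> A) (X : 'I_t -> A) : Prop :=
  [/\ forall a, K a ^+ m a = 1,
      forall a a', K a * K a' = K a' * K a,
      forall a k, K a * X k = w a k *: (X k * K a),
      forall k, X k ^+ 2 = 0 &
      forall k l, X l * X k = b k l *: (X k * X l)].

(** The universal property of generators and relations; with w and b the appropriate roots of unity
    it unfolds to the same statement as [nenciu_algebra]. *)
Definition skew_presented (A : algType F) (K : 'I_s -> A) (X : 'I_t -> A) : Prop :=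
  [/\ skew_relations K X,
      forall (B : algType F) (K' : 'I_s -> B) (X' : 'I_t -> B),
        skew_relations K' X' ->
        exists f : {lrmorphism A -> B},
          (forall a, f (K a) = K' a) /\ (forall k, f (X k) = X' k) &
      forall (B : algType F) (f g : {lrmorphism A -> B}),
        (forall a, f (K a) = g (K a)) -> (forall k, f (X k) = g (X k)) ->
        f =1 g].

End Presentation.

(** * The representation on subsets of the nilpotent generators *)

Section Model.
Variables (F : fieldType) (s t : nat).
Variables (m : 'I_s -> nat) (w : 'I_s -> 'I_t -> F) (b : 'I_t -> 'I_t -> F).
Hypothesis m_gt0 : forall a, (0 < m a)%N.
Hypothesis w_unity : forall a k, w a k ^+ m a = 1.
Hypothesis b_skew : forall k l, b k l * b l k = 1.
Variables (lam : 'I_s -> F).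
Hypothesis lam_unity : forall a, lam a ^+ m a = 1.
Local Notation T := {set 'I_t}.
Variables (n : nat) (rk : T -> 'I_n.+1) (vl : 'I_n.+1 -> T).
Hypotheses (rkK : cancel rk vl) (vlK : cancel vl rk).
Local Notation vec := (mono_vec F rk).

(** The subset S stands for the increasing product of the X_j, j in S, applied to a vector on which
    each K_a acts by [lam a]. The coefficient arises from moving X_k past the X_j with j < k. *)
Definition model_coef (k : 'I_t) (S : T) : F :=
  if k \in S then 0 else \prod_(j in S | (j < k)%N) b j k.

Definition model_weight (a : 'I_s) (S : T) : F := lam a * \prod_(k in S) w a k.

Definition model_X k := mono_mx rk vl (model_coef k) (fun S => k |: S).
Definition model_K a := mono_mx rk vl (model_weight a) id.

Lemma model_XE k S : model_X k *m vec S = model_coef k S *: vec (k |: S).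
Proof. exact: (mono_mxE rkK). Qed.
Lemma model_KE a S : model_K a *m vec S = model_weight a S *: vec S.
Proof. exact: (mono_mxE rkK). Qed.

Lemma model_coef_neq0 k (S : T) : k \notin S -> model_coef k S != 0.
Proof.
move=> /negPf kS; rewrite /model_coef kS; apply/prodf_neq0 => j _.
by apply: contra_eq_neq (b_skew j k) => ->; rewrite mul0r eq_sym oner_neq0.
Qed.

Lemma model_weight_unity a S : model_weight a S ^+ m a = 1.
Proof. by rewrite exprMn lam_unity mul1r -prodrXl big1. Qed.

Lemma model_weight_neq0 a S : model_weight a S != 0.
Proof.
by have := oner_neq0 F; rewrite -(model_weight_unity a S) expf_eq0 m_gt0.
Qed.

Lemma model_KnE a k S : model_K a ^+ k *m vec S = model_weight a S ^+ k *: vec S.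
Proof.
elim: k => [|k IH]; first by rewrite !expr0 mul1mx scale1r.
by rewrite exprS mulmx_act IH -scalemxAr model_KE scalerA -exprSr.
Qed.

(** Only a new element smaller than l adds a factor to the coefficient of X_l. *)
Lemma model_coefU k l (S : T) : k != l ->
  model_coef l (k |: S)
  = (if (k < l)%N && (k \notin S) then b k l else 1) * model_coef l S.
Proof.
move=> kl; rewrite /model_coef in_setU1 (eq_sym l) (negPf kl) /=.
case: ifP => lS; first by rewrite mulr0.
have [kS|kS] /= := boolP (k \in S).
  by rewrite andbF mul1r (setUidPr _) // sub1set.
rewrite andbT; have [lkl|lkl] := boolP (k < l)%N.
  rewrite (bigD1 k) /=; last by rewrite setU11.
  congr (_ * _); apply: eq_bigl => j; rewrite in_setU1.
  by case: (eqVneq j k) => [->|jk] /=; rewrite ?(negPf kS) ?andbF ?andbT.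
rewrite mul1r; apply: eq_bigl => j; rewrite in_setU1.
by case: (eqVneq j k) => [->|//]; rewrite (negPf lkl) !andbF.
Qed.

Lemma model_relations : skew_relations m w b model_K model_X.
Proof.
split=> [a|a a'|a k|k|k l]; apply: (mono_ext vlK) => S.
- by rewrite model_KnE model_weight_unity scale1r mul1mx.
- by rewrite !mulmx_act !model_KE -!scalemxAr !model_KE !scalerA mulrC.
- rewrite -scalemxAl !mulmx_act model_KE -scalemxAr !model_XE -scalemxAr model_KE.
  rewrite !scalerA /model_coef; case: ifP => kS; first by rewrite !(mulr0, mul0r).
  congr (_ *: _); rewrite /model_weight big_setU1 ?kS //=.
  by ring.
- rewrite expr2 mulmx_act model_XE -scalemxAr model_XE scalerA mul0mx.
  by rewrite {2}/model_coef setU11 mulr0 scale0r.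
rewrite -scalemxAl !mulmx_act !model_XE -!scalemxAr !model_XE !scalerA.
rewrite setUCA; congr (_ *: _).
case: (eqVneq k l) => [->|kl].
  by rewrite /model_coef setU11 !mulr0.
have lk : l != k by rewrite eq_sym.
(* Exactly one of the two orders of inserting k and l picks up a factor: [b k l] if k < l, which is
   the one required, and [b l k] on the other side if l < k, where [b_skew] concludes. *)
rewrite !model_coefU //.
case: (ltngtP k l) => [lt_kl|lt_lk|/val_inj eq_kl]; last by rewrite eq_kl eqxx in kl.
  have [kS|kS] := boolP (k \in S); first by rewrite /model_coef kS !(mulr0, mul0r).
  by rewrite /= !mul1r; ring.
have [lS|lS] := boolP (l \in S); first by rewrite /model_coef lS !(mulr0, mul0r).
rewrite /= !mul1r -[RHS]mulrA -[LHS]mul1r -(b_skew k l); ring.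
Qed.

Lemma model_lift (A : algType F) (K : 'I_s -> A) (X : 'I_t -> A) :
  skew_presented m w b K X ->
  exists2 f : {lrmorphism A -> 'M[F]_n.+1},
    (forall a S, f (K a) *m vec S = model_weight a S *: vec S) &
    (forall k S, f (X k) *m vec S = model_coef k S *: vec (k |: S)).
Proof.
case=> _ /(_ _ _ _ model_relations)[f [fK fX]] _; exists f => [a|k] S.
  by rewrite fK model_KE.
by rewrite fX model_XE.
Qed.

End Model.

(** The size has the form n.+1 because square matrices form a nonzero ring only then; [t0] witnesses
    that T is nonempty. *)
Lemma finite_coding (T : finType) (t0 : T) :
  exists n (rk : T -> 'I_n.+1) (vl : 'I_n.+1 -> T), cancel rk vl /\ cancel vl rk.
Proof.
have cT : #|T| = #|T|.-1.+1 by rewrite prednK //; apply/card_gt0P; exists t0.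
exists #|T|.-1, (fun x => cast_ord cT (enum_rank x)).
exists (fun i => enum_val (cast_ord (esym cT) i)); split=> i.
  by rewrite cast_ordK enum_rankK.
by rewrite enum_valK cast_ordKV.
Qed.

(** * Consequences of the presentation *)

Section Presented.
Variables (F : fieldType) (s t : nat).
Variables (m : 'I_s -> nat) (w : 'I_s -> 'I_t -> F) (b : 'I_t -> 'I_t -> F).
Hypothesis m_gt0 : forall a, (0 < m a)%N.
Variables (A : falgType F) (K : 'I_s -> A) (X : 'I_t -> A).
Hypothesis hA : skew_presented m w b K X.

Definition torus_pow (v : 'rV[int]_s) : A := \prod_a K a ^ v 0 a.
Definition xpow (r : 'I_t -> 'Z_2) : A := \prod_k X k ^+ r k.

Lemma K_unit a : K a \is a GRing.unit.
Proof.
have [[Km _ _ _ _] _ _] := hA.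
by rewrite -(unitrX_pos _ (m_gt0 a)) Km unitr1.
Qed.

(** Induction for torus elements; inverses account for the negative exponents. *)
Lemma kpow_ind (P : A -> Prop) v :
  P 1 -> (forall x y, P x -> P y -> P (x * y)) -> (forall a, P (K a)) ->
  (forall x, x \is a GRing.unit -> P x -> P x^-1) -> P (torus_pow v).
Proof.
move=> P1 PM PK PV; apply: big_ind => // a _.
have PX k : P (K a ^+ k) by elim: k => [|k IH]; rewrite ?expr0 // exprS; apply: PM.
case: (v 0 a) => k; first exact: PX.
by apply: PV; [rewrite unitrX ?K_unit | exact: PX].
Qed.

Lemma kpow_unit v : torus_pow v \is a GRing.unit.
Proof.
apply: (kpow_ind (P := fun x => x \is a GRing.unit)); rewrite ?unitr1 //.
- by move=> x y ux uy; rewrite unitrMl.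
- exact: K_unit.
- by move=> x ux _; rewrite unitrV.
Qed.

(** V is a subalgebra satisfying the relations, so the presentation maps A into it; followed by the
    inclusion this is an endomorphism fixing the generators, hence the identity. *)
Lemma generation (V : {vspace A}) :
  1 \in V -> (forall a, K a \in V) -> (forall k, X k \in V) ->
  (forall x y, x \in V -> y \in V -> x * y \in V) -> forall h, h \in V.
Proof.
move=> V1 VK VX VM.
have aV : is_aspace V.
  by rewrite /is_aspace has_algid1 //=; apply/prodvP => x y; exact: VM.
pose V' := ASpace aV.
have e1 : algid V' = 1 by apply/eqP; rewrite algid_eq1.
have [rel ex uniq] := hA.
have [Km KK KX X2 XX] := rel.
pose K' a : subvs_of V' := Subvs (VK a); pose X' k : subvs_of V' := Subvs (VX k).
have rel' : skew_relations m w b K' X'.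
  have vX (x : subvs_of V') k : vsval (x ^+ k) = vsval x ^+ k.
    by elim: k => [|k IH]; rewrite ?expr0 ?exprS //= ?e1 // IH.
  split=> *; apply: val_inj => //=; rewrite ?vX ?linearZ //= ?e1 ?linear0 -?expr2 //.
have [f [fK fX]] := ex _ _ _ rel'.
pose g x := vsval (f x).
have lin_g : linear g by move=> k x y; rewrite /g !linearP.
have mul_g : monoid_morphism g.
  by split=> [|x y]; rewrite /g ?rmorph1 ?rmorphM //= e1.
pose gg : {lrmorphism A -> A} := HB.pack g (GRing.isLinear.Build _ _ _ _ _ lin_g)
  (GRing.isMonoidMorphism.Build _ _ _ mul_g).
have gid : gg =1 @idfun A.
  by apply: uniq => [a|k] /=; rewrite /g ?fK ?fX.
by move=> h; rewrite -[h]/(idfun h) -gid; exact: subvsP.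
Qed.

(** The elements h with this property form a subspace containing 1 and the generators and closed
    under products, so [generation] applies. *)
Lemma X_normal k h : exists h', X k * h = h' * X k.
Proof.
have [[Km KK KX X2 XX] _ _] := hA.
pose V := (amull (X k) @^-1: ({:A} * <[X k]>))%VS.
have VP g : reflect (exists h', X k * g = h' * X k) (g \in V).
  rewrite -memv_preim lfunE /=; apply: (iffP memv_cosetP).
    by case=> h' _ ->; exists h'.
  by case=> h' ->; exists h'; rewrite ?memvf.
have wK a : exists c, X k * K a = c *: K a * X k.
  (* If [w a k] is zero, the relation and the invertibility of K_a force X_k = 0. *)
  have [w0|w0] := eqVneq (w a k) 0; last first.
    by exists (w a k)^-1; rewrite -scalerAl KX scalerA mulVf // scale1r.
  have XK : X k = 0.
    by apply: (mulrI (K_unit a)); rewrite KX w0 scale0r mulr0.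
  by exists 0; rewrite XK mul0r mulr0.
apply/VP; apply: generation.
- by apply/VP; exists 1; rewrite mulr1 mul1r.
- by move=> a; apply/VP; have [c ->] := wK a; exists (c *: K a).
- by move=> j; apply/VP; exists (b j k *: X j); rewrite XX -scalerAl.
move=> x y /VP[x' xE] /VP[y' yE]; apply/VP; exists (x' * y').
by rewrite mulrA xE -mulrA yE mulrA.
Qed.

Lemma X_kills k y h : X k * y = 0 -> X k * (h * y) = 0.
Proof. by have [h' hE] := X_normal k h; rewrite mulrA hE -mulrA => ->; rewrite mulr0. Qed.

(** X_k moves right, up to scalars, until it meets its own occurrence in the product, where X_k^2 =
    0. *)
Lemma X_xpow k r : r k != 0 -> X k * xpow r = 0.
Proof.
have [[_ _ _ X2 XX] _ _] := hA.
move=> rk; rewrite /xpow.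
have : k \in index_enum 'I_t by rewrite mem_index_enum.
elim: (index_enum _) => [|j js IH] //; rewrite in_cons big_cons.
have [<- _|kj /= kjs] := eqVneq k j.
  have -> : r k = 1 :> nat by case: (r k) rk => [[|[|]]].
  by rewrite expr1 mulrA -expr2 X2 mul0r.
rewrite mulrA.
suff -> : X k * X j ^+ r j = b j k ^+ r j *: (X j ^+ r j * X k).
  by rewrite -scalerAl -mulrA IH // mulr0 scaler0.
elim: (nat_of_ord (r j)) => [|i IHi]; first by rewrite !expr0 scale1r mulr1 mul1r.
by rewrite exprSr mulrA IHi -scalerAl -(mulrA _ (X k)) (XX j k) -scalerAr scalerA !mulrA -!exprSr.
Qed.

Hypothesis w_unity : forall a k, w a k ^+ m a = 1.
Hypothesis b_skew : forall k l, b k l * b l k = 1.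

(** A linear form that singles out X_i among all X_j applied to a module generator, even after
    multiplication by a torus element. It is a matrix coefficient of the subset model. *)
Lemma X_functional (lam : 'I_s -> F) (c : forall a, 'I_(m a) -> F) r i :
  (forall a, lam a ^+ m a = 1) -> (forall a j, c a j * lam a ^+ j = 1) ->
  (forall a, (m a)%:R != 0 :> F) -> r i = 0 ->
  exists phi : {linear A -> F^o},
    forall j v,
      (phi (torus_pow v * X j * (xpow r * \prod_a ((m a)%:R^-1 *: \sum_(j < m a) c a j *: K a ^+ j)))
       == 0) = (j != i).
Proof.
move=> lam1 cE m0 ri.
have [n [rk [vl [rkK vlK]]]] := finite_coding (set0 : {set 'I_t}).
have [f fK fX] := model_lift w_unity b_skew lam1 rkK vlK hA.
set om := \prod_a _.
pose S := [set k | r k != 0].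
pose e T := mono_vec F rk T.
(* Torus elements act on every basis vector by a nonzero scalar. *)
pose eig T h := exists2 mu, mu != 0 & f h *m e T = mu *: e T.
have eig1 T : eig T 1 by exists 1; rewrite ?oner_neq0 // rmorph1 mul1mx scale1r.
have eigM T x y : eig T x -> eig T y -> eig T (x * y).
  move=> [mu mu0 xE] [nu nu0 yE]; exists (nu * mu); first by rewrite mulf_neq0.
  by rewrite rmorphM mulmx_act yE -scalemxAr xE scalerA.
have eigK T v : eig T (torus_pow v).
  apply: (kpow_ind (P := eig T)) => // [|a|x ux [mu mu0 xE]]; first exact: eigM.
    by exists (model_weight w lam a T); rewrite ?fK // (model_weight_neq0 m_gt0).
  exists mu^-1; rewrite ?invr_eq0 //.
  apply: (can_inj (scalerK mu0)); rewrite scalerA divff // scale1r.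
  by rewrite scalemxAr -xE -mulmx_act -rmorphM mulVr // rmorph1 mul1mx.
(* K_a acts on the empty set by [lam a], so by the choice of c each factor of [om] averages m_a
   copies of the same vector. *)
have omE : f om *m e set0 = e set0.
  rewrite /om rmorph_prod; apply: (big_ind (fun g => g *m e set0 = e set0)).
  - by rewrite mul1mx.
  - by move=> g h gE hE; rewrite mulmx_act hE gE.
  move=> a _ /=; rewrite linearZ /= linear_sum /= -scalemxAl mulmx_suml.
  have KnE k : f (K a ^+ k) *m e set0 = lam a ^+ k *: e set0.
    elim: k => [|k IH]; first by rewrite expr0 rmorph1 mul1mx scale1r.
    rewrite exprS rmorphM mulmx_act IH -scalemxAr fK /model_weight big_set0 mulr1.
    by rewrite scalerA -exprSr.
  rewrite (eq_bigr (fun=> e set0)); last first.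
    by move=> j _; rewrite linearZ /= -scalemxAl KnE scalerA cE scale1r.
  by rewrite sumr_const card_ord -scaler_nat scalerA mulVf // scale1r.
(* Each X_k occurring in the product adds a new element, so no coefficient vanishes; the support is
   written over the list of indices to allow induction on it. *)
have [ga ga0 xE] : exists2 ga, ga != 0 & f (xpow r) *m e set0 = ga *: e S.
  rewrite /xpow (_ : S = [set k in index_enum 'I_t | r k != 0]); last first.
    by apply/setP=> k; rewrite !inE mem_index_enum.
  have : uniq (index_enum 'I_t) by rewrite index_enum_uniq.
  elim: (index_enum _) => [_|k ks IH /=].
    exists 1; rewrite ?oner_neq0 // big_nil rmorph1 mul1mx scale1r.
    by congr e; apply/setP=> k; rewrite !inE.
  case/andP=> kks /IH[ga ga0 gaE]; rewrite big_cons rmorphM mulmx_act gaE -scalemxAr.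
  have [rk0|rk0] := eqVneq (r k) 0.
    exists ga => //; rewrite rk0 expr0 rmorph1 mul1mx; congr (_ *: e _).
    apply/setP=> j; rewrite !inE.
    by case: (eqVneq j k) => [->|//]; rewrite rk0 eqxx !andbF.
  have -> : r k = 1 :> nat by case: (r k) rk0 => [[|[|]]].
  rewrite expr1 fX; set T := [set _ in ks | _].
  have kT : k \notin T by rewrite inE (negPf kks).
  exists (ga * model_coef b k T); first by rewrite mulf_neq0 // model_coef_neq0.
  rewrite scalerA; congr (_ *: e _).
  apply/setP=> j; rewrite !inE.
  by case: (eqVneq j k) => [->|//]; rewrite rk0.
(* The coordinate at i |: S of h applied to the empty set. X_j gives zero if j is in S and otherwise
   a nonzero multiple of j |: S, which equals i |: S only for j = i. *)
pose phi (h : A) : F^o := (f h *m e set0) (rk (i |: S)) 0.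
have lin_phi : linear phi.
  by move=> k x y; rewrite /phi linearP mulmxDl -scalemxAl !mxE.
pose phil : {linear A -> F^o} := HB.pack phi (GRing.isLinear.Build _ _ _ _ _ lin_phi).
exists phil => j v; rewrite -[phil _]/(phi _).
have iS : i \notin S by rewrite inE ri eqxx.
have [mu mu0 vE] := eigK (j |: S) v.
rewrite /phi !rmorphM !mulmx_act omE xE -!scalemxAr fX -!scalemxAr vE !scalerA mxE.
rewrite (mono_vecE F rkK).
rewrite !mulf_eq0 (negPf ga0) (negPf mu0) /=.
have [jS|jS] := boolP (j \in S).
  rewrite /model_coef jS eqxx /=; symmetry.
  by apply: contraNneq iS => <-.
rewrite (negPf (model_coef_neq0 b_skew jS)) /=.
case: (eqVneq j i) => [->|ji]; first by rewrite eqxx oner_eq0.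
case: (i |: S =P j |: S) => [eqS|_]; last by rewrite eqxx.
have : j \in i |: S by rewrite eqS setU11.
by rewrite in_setU1 (negPf ji) (negPf jS).
Qed.

End Presented.

(** * The monodromy *)

Section Monodromy.
Variables (F : fieldType) (s t : nat).
Hypothesis F_char0 : forall n, (0 < n)%N -> n%:R != 0 :> F.
Variables (m : 'I_s -> nat) (w : 'I_s -> 'I_t -> F) (b : 'I_t -> 'I_t -> F).
Hypothesis m_gt0 : forall a, (0 < m a)%N.
Hypothesis w_unity : forall a k, w a k ^+ m a = 1.
Hypothesis b_skew : forall k l, b k l * b l k = 1.
Hypothesis b_diag : forall k, b k k = -1.
Variables (u : 'M[int]_(t, s)).
Hypothesis b_u : forall k l, b k l = \prod_a w a k ^ u l a.
Variables (H : falgType F) (K : 'I_s -> H) (X : 'I_t -> H) (hH : hopf H).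
Hypothesis hA : skew_presented m w b K X.
Local Notation kpow := (torus_pow K).
Hypothesis comulK : forall a, comul hH (K a) = tpure (K a) (K a).
Hypothesis comulX : forall k,
  comul hH (X k) = tpure 1 (X k) + tpure (X k) (kpow (row k u)).
Variables (t2 : nat) (Z : 'I_t2 * bool -> 'I_t) (alpha : 'I_t2 -> F).
Hypothesis Z_inj : injective Z.
Hypothesis Z_anti : forall i j, i != j -> X (Z i) * X (Z j) = - (X (Z j) * X (Z i)).
Hypothesis Z_opp : forall l,
  kpow (row (Z (l, false)) u) = (kpow (row (Z (l, true)) u))^-1.
Variables (Rz : tens H H) (I : finType) (cz : I -> F) (v1 v2 : I -> 'rV[int]_s).
Hypothesis RzE : Rz = \sum_i cz i *: tpure (kpow (v1 i)) (kpow (v2 i)).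
Hypothesis Rz_flip : Rz * tflip Rz = 1.

Let L l := kpow (row (Z (l, true)) u).
(** The index (l, e) stands for Z_l^+ or Z_l^-, and negating e gives the opposite generator; both
    kinds of terms of the exponent are thus treated at once. *)
Let tau i := tpure (X (Z i)) (L i.1 * X (Z (i.1, ~~ i.2))) : tens H H.

Definition nil_part : tens H H := \sum_(l < t2) alpha l *:
    (tpure (X (Z (l, true)))
           (kpow (row (Z (l, true)) u) * X (Z (l, false)))
     - tpure (X (Z (l, false)))
             (kpow (row (Z (l, true)) u) * X (Z (l, true)))).
Local Notation x := nil_part.
Local Notation Q := (Rz * nilexp x).
Hypothesis hR : is_Rmatrix hH Q.

Let K_comm a a' : K a * K a' = K a' * K a.
Proof. by have [[_ ? _ _ _] _ _] := hA. Qed.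

Lemma kpow_comm v v' : GRing.comm (kpow v) (kpow v').
Proof.
apply: (kpow_ind m_gt0 hA (P := fun g => GRing.comm g (kpow v'))).
- exact/commr_sym/commr1.
- by move=> g h cg ch; apply/commr_sym/commrM; apply: commr_sym.
- move=> a; apply: (kpow_ind m_gt0 hA (P := GRing.comm (K a))).
  + exact: commr1.
  + by move=> g h; exact: commrM.
  + by move=> a'; exact: K_comm.
  + by move=> g _ cg; exact: commrV.
- by move=> g _ cg; apply/commr_sym/commrV/commr_sym.
Qed.

Lemma kpow_X v k : kpow v * X k = (\prod_a w a k ^ v 0 a) *: (X k * kpow v).
Proof.
have [[_ _ KX _ _] _ _] := hA.
have w0 a : w a k != 0.
  by have := oner_neq0 F; rewrite -(w_unity a k) expf_eq0 m_gt0.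
rewrite /torus_pow; elim/big_rec2: _ => [|a c g _ IH]; first by rewrite mulr1 mul1r scale1r.
have KnX n : K a ^+ n * X k = w a k ^+ n *: (X k * K a ^+ n).
  elim: n => [|n IHn]; first by rewrite !expr0 mulr1 mul1r scale1r.
  by rewrite exprS -mulrA IHn -scalerAr !mulrA KX -scalerAl scalerA -!mulrA -exprS mulrC -exprS.
have KzX (z : int) : K a ^ z * X k = w a k ^ z *: (X k * K a ^ z).
  case: z => n; first exact: KnX.
  have uK : K a ^+ n.+1 \is a GRing.unit by rewrite unitrX // (K_unit m_gt0 hA).
  rewrite !NegzE -!exprnN.
  apply: (mulrI uK); rewrite mulrA divrr // mul1r -scalerAr mulrA KnX -scalerAl.
  by rewrite mulrK // scalerA mulVf ?scale1r // expf_neq0.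
by rewrite -mulrA IH -scalerAr mulrA KzX -scalerAl scalerA mulrA mulrC.
Qed.

Lemma morph_kpow (f : {lrmorphism H -> H}) v :
  (forall a, f (K a) = K a) -> f (kpow v) = kpow v.
Proof.
move=> fK; apply: (kpow_ind m_gt0 hA (P := fun g => f g = g)) => //.
- by rewrite /= rmorph1.
- by move=> g h /= gE hE; rewrite rmorphM /= gE hE.
- by move=> g ug /= gE; rewrite rmorphV //= gE.
Qed.

Lemma comul_kpow v : comul hH (kpow v) = tpure (kpow v) (kpow v).
Proof.
apply: (kpow_ind m_gt0 hA (P := fun g => comul hH g = tpure g g)) => //.
- by rewrite /= rmorph1.
- by move=> g h /= gE hE; rewrite rmorphM /= gE hE tpureM.
move=> g ug /= gE; rewrite rmorphV //= gE.
have e1 : tpure g g * tpure g^-1 g^-1 = 1 :> tens H H by rewrite tpureM divrr.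
have e2 : tpure g^-1 g^-1 * tpure g g = 1 :> tens H H by rewrite tpureM mulVr.
have ut : (tpure g g : tens H H) \is a GRing.unit.
  by apply/unitrP; exists (tpure g^-1 g^-1).
by apply: (mulrI ut); rewrite divrr // e1.
Qed.

(** The relations are homogeneous in each X_k, so any set of nilpotent generators may be sent to
    zero. *)
Lemma projection (P : pred 'I_t) :
  exists2 f : {lrmorphism H -> H}, forall a, f (K a) = K a &
    forall k, f (X k) = if P k then X k else 0.
Proof.
have [[Km KK KX X2 XX] ex _] := hA.
have /ex[f [fK fX]] : skew_relations m w b K (fun k => if P k then X k else 0).
  split=> // [a k|k|k l].
  - by case: ifP; rewrite ?mulr0 ?mul0r ?scaler0.
  - by case: ifP; rewrite ?expr0n.
  - by case: ifP; case: ifP; rewrite ?mulr0 ?mul0r ?scaler0.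
by exists f.
Qed.

Lemma XX_neq0 i j : i != j -> X i * X j != 0.
Proof.
move=> ij.
(* For the indicator r of j one has X^r = X_j. With the trivial character, the form that detects X_i
   is nonzero on X_i X_j times an idempotent. *)
pose r k : 'Z_2 := if k == j then 1 else 0.
have ri : r i = 0 by rewrite /r (negPf ij).
have cE a (n : 'I_(m a)) : (1 : F) * 1 ^+ n = 1 by rewrite expr1n mulr1.
have [phi phiE] := X_functional m_gt0 hA w_unity b_skew (fun a => expr1n F (m a))
  cE (fun a => F_char0 (m_gt0 a)) ri.
have := phiE i 0; rewrite eqxx => /negbT; apply: contraNneq => XX0.
have -> : xpow X r = X j.
  rewrite /xpow (eq_bigr (fun k => if k == j then X k else 1)).
    by rewrite -big_mkcond big_pred1_eq.
  by move=> k _; rewrite /r; case: eqP => _; rewrite (expr0, expr1).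
by rewrite -mulrA (mulrA (X i)) XX0 mul0r mulr0 linear0.
Qed.

Lemma X_neq0 i j : i != j -> X i != 0.
Proof. by move=> /XX_neq0; apply: contraNneq => ->; rewrite mul0r. Qed.

Let flip_neq (i : 'I_t2 * bool) : i != (i.1, ~~ i.2).
Proof. by case: i => l []; rewrite xpair_eqE andbF. Qed.

Lemma XZ_neq0 i : X (Z i) != 0.
Proof. by apply: (@X_neq0 _ (Z (i.1, ~~ i.2))); rewrite (inj_eq Z_inj). Qed.

(** The commutation factor is b between Z_i and Z_l^+. It is -1 on the diagonal by [b_diag], and
    otherwise because the two generators anticommute and their product is nonzero. *)
Lemma L_Z l i : L l * X (Z i) = - (X (Z i) * L l).
Proof.
rewrite /L kpow_X.
rewrite (eq_bigr (fun a => w a (Z i) ^ u (Z (l, true)) a)); last first.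
  by move=> a _; rewrite mxE.
rewrite -b_u; have [->|il] := eqVneq i (l, true); first by rewrite b_diag scaleN1r.
suff -> : b (Z i) (Z (l, true)) = -1 by rewrite scaleN1r.
have [[_ _ _ _ XX] _ _] := hA.
have := Z_anti il; rewrite eq_sym -(inj_eq Z_inj) in il; move=> ZZ.
have /eqP : (b (Z i) (Z (l, true)) + 1) *: (X (Z (l, true)) * X (Z i)) = 0.
  by rewrite scalerDl scale1r [X in _ + X]XX ZZ scalerN addrN.
by rewrite scaler_eq0 (negPf (XX_neq0 il)) orbF addr_eq0 => /eqP.
Qed.

(** Exchanging the nilpotent generators gives one sign in each tensor factor, and moving the
    grouplike elements to the left costs the same sign on both sides. *)
Lemma tau_comm i j : GRing.comm (tau i) (tau j).
Proof.
have [->|ij] := eqVneq i j; first by [].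
have ij' : (i.1, ~~ i.2) != (j.1, ~~ j.2).
  by case: i j ij => l e [l' e']; rewrite !xpair_eqE (inj_eq negb_inj).
rewrite /GRing.comm /tau !tpureM (Z_anti ij).
have move_L l l' k k' : L l * X (Z k) * (L l' * X (Z k')) = - (L l * L l' * (X (Z k) * X (Z k'))).
  by rewrite !mulrA -(mulrA (L l)) -[X (Z k) * L l']opprK -L_Z mulrN mulNr !mulrA.
by rewrite !move_L (Z_anti ij') mulrN opprK (kpow_comm _ _ : L i.1 * L j.1 = _) tpureNl tpureNr.
Qed.

Lemma tau_sq i : tau i ^+ 2 = 0.
Proof.
have [[_ _ _ X2 _] _ _] := hA.
by rewrite expr2 tpureM -expr2 X2 tpure0l.
Qed.

Let cf (i : 'I_t2 * bool) : F := if i.2 then alpha i.1 else - alpha i.1.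

Lemma nil_partE : x = \sum_i cf i *: tau i.
Proof.
transitivity (\sum_l \sum_e cf (l, e) *: tau (l, e)); last first.
  by rewrite pair_bigA; apply: eq_bigr => -[].
apply: eq_bigr => l _; rewrite big_bool /= /cf /tau /= scaleNr -scalerBr.
by [].
Qed.

Lemma nil_part_nilpotent : nilpotent x.
Proof.
rewrite nil_partE; apply: nilpotent_sum => [i j|i].
  by rewrite /GRing.comm -!scalerAl -!scalerAr tau_comm scalerA mulrC -scalerA.
by apply: nilpotentZ; exists 2; exact: tau_sq.
Qed.

(** * Projections of the R-matrix *)

Lemma tmap_Rz (f g : {lrmorphism H -> H}) :
  (forall a, f (K a) = K a) -> (forall a, g (K a) = K a) -> tmap f g Rz = Rz.
Proof.
move=> fK gK; rewrite RzE linear_sum; apply: eq_bigr => i _.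
by rewrite linearZ /= tmapE /= (morph_kpow _ fK) (morph_kpow _ gK).
Qed.

Lemma tmap_tau0 (f g : {lrmorphism H -> H}) i :
  f (X (Z i)) = 0 \/ g (X (Z (i.1, ~~ i.2))) = 0 -> tmap f g (tau i) = 0.
Proof.
by case=> fg0; rewrite tmapE ?rmorphM /= fg0 ?mulr0 ?tpure0l ?tpure0r.
Qed.

Lemma tmap_Q (f g : {lrmorphism H -> H}) :
  (forall a, f (K a) = K a) -> (forall a, g (K a) = K a) ->
  tmap f g Q = Rz * nilexp (\sum_i cf i *: tmap f g (tau i)).
Proof.
move=> fK gK; rewrite rmorphM /= tmap_Rz //; congr (_ * _).
rewrite (nilexp_morph (tmap f g) nil_part_nilpotent) nil_partE linear_sum.
by congr nilexp; apply: eq_bigr => i _; rewrite linearZ.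
Qed.

Lemma nilexp0 (A : falgType F) : nilexp 0 = 1 :> A.
Proof. by rewrite nilexp_sq0 ?addr0 // expr0n. Qed.

(** Every term of the exponent has a nilpotent generator in both factors, so only R_z survives. *)
Lemma tmap_Q0 (f g : {lrmorphism H -> H}) :
  (forall a, f (K a) = K a) -> (forall a, g (K a) = K a) ->
  (forall k, f (X k) = 0) \/ (forall k, g (X k) = 0) -> tmap f g Q = Rz.
Proof.
move=> fK gK fg0; rewrite tmap_Q // big1 ?nilexp0 ?mulr1 // => i _.
by rewrite tmap_tau0 ?scaler0 //; case: fg0 => ->; [left|right].
Qed.

(** With the nilpotent generators killed in the first factor, one term of the coproduct of X_k and
    one of its flip remain; [Rz_X1] uses the second factor instead. *)
Lemma Rz_1X k : Rz * tpure 1 (X k) = tpure (kpow (row k u)) (X k) * Rz.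
Proof.
have [f fK fX] := projection pred0.
have [_ /(_ (X k)) + _ _] := hR => /(congr1 (tmap f idfun)).
rewrite [LHS]rmorphM [RHS]rmorphM /= (tmap_Q0 (g := idfun)) //; last by left.
rewrite comulX !linearD /= !tflipE !tmapE /= fX rmorph1 morph_kpow //.
by rewrite !tpure0l addr0 add0r.
Qed.

Lemma Rz_X1 k : Rz * tpure (X k) (kpow (row k u)) = tpure (X k) 1 * Rz.
Proof.
have [f fK fX] := projection pred0.
have [_ /(_ (X k)) + _ _] := hR => /(congr1 (tmap idfun f)).
rewrite [LHS]rmorphM [RHS]rmorphM /= (tmap_Q0 (f := idfun)) //; last by right.
rewrite comulX !linearD /= !tflipE !tmapE /= fX rmorph1 morph_kpow //.
by rewrite !tpure0r addr0 add0r.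
Qed.

Lemma Rz_unit : Rz \is a GRing.unit.
Proof.
apply/unitrP; exists (tflip Rz); split=> //.
by rewrite -[X in _ * X](tflipK Rz) -rmorphM /= Rz_flip rmorph1.
Qed.

Lemma tmap_leg13 (f g h : {lrmorphism H -> H}) y :
  tmap (tmap f g) h (leg13 y) = leg13 (tmap f h y).
Proof.
move: y; apply: tens_ext => [k y y'|k y y'|a c].
- by rewrite !linearP.
- by rewrite !linearP.
by rewrite leg13E !tmapE /= leg13E tmapE rmorph1.
Qed.

Lemma tmap_leg12 (f g h : {lrmorphism H -> H}) y :
  tmap (tmap f g) h (leg12 y) = leg12 (tmap f g y).
Proof. by rewrite /leg12 tmapE rmorph1. Qed.

(** * The second hexagon identity and the order of L_l *)

Section Hexagon.
Variables f g h : {lrmorphism H -> H}.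
Hypotheses (fK : forall a, f (K a) = K a) (gK : forall a, g (K a) = K a)
  (hK : forall a, h (K a) = K a).

(* (f (x) g (x) h) (id (x) Delta), the left side of the second hexagon identity. *)
Definition coact (y : tens H H) : tens (tens H H) H :=
  tmap (tmap f g) h (tassoc (tmap idfun (comul hH) y)).

Lemma coactM : {morph coact : y y' / y * y'}.
Proof. by move=> y y'; rewrite /coact !rmorphM. Qed.

Lemma coactE a c : coact (tpure a c) = tmap (tmap f g) h (tassoc (tpure a (comul hH c))).
Proof. by rewrite /coact tmapE. Qed.

Fact coact_linear : linear coact.
Proof. by move=> k y1 y2; rewrite /coact !linearP. Qed.

Fact coact_monoid_morphism : monoid_morphism coact.
Proof. by split; [rewrite /coact !rmorph1 | exact: coactM]. Qed.

Definition coact_lrmorphism : {lrmorphism tens H H -> tens (tens H H) H} :=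
  HB.pack coact (GRing.isLinear.Build _ _ _ _ _ coact_linear)
    (GRing.isMonoidMorphism.Build _ _ _ coact_monoid_morphism).

Lemma coact_sum (J : finType) (c : J -> F) (y : J -> tens H H) :
  coact (\sum_j c j *: y j) = \sum_j c j *: coact (y j).
Proof.
rewrite -[coact]/(coact_lrmorphism : _ -> _) linear_sum.
by apply: eq_bigr => j _; rewrite linearZ.
Qed.

(** The right side does not involve f, g, h, so these may be exchanged for other maps fixing the
    torus. *)
Lemma coact_Rz :
  coact Rz = \sum_i cz i *: tpure (tpure (kpow (v1 i)) (kpow (v2 i))) (kpow (v2 i)).
Proof.
rewrite RzE coact_sum; apply: eq_bigr => i _; rewrite coactE comul_kpow tassocE !tmapE /=.
by rewrite tmapE /= (morph_kpow _ fK) (morph_kpow _ gK) (morph_kpow _ hK).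
Qed.

Hypothesis hX : forall k, h (X k) = 0.

(** Since h kills the nilpotent generators, only the term X (x) K^u of the coproduct survives and
    puts a grouplike element in the third leg. *)
Lemma coact_tau i :
  coact (tau i) = tpure (tmap f g (tau i)) (L i.1 * kpow (row (Z (i.1, ~~ i.2)) u)).
Proof.
rewrite coactE rmorphM /= comul_kpow comulX mulrDr !tpureM tpureDr linearD linearD /=.
rewrite !tassocE !tmapE /= mulr1 !rmorphM /= hX mulr0 tpure0r add0r.
by rewrite !(morph_kpow _ hK) tmapE rmorphM.
Qed.

Lemma coact_nilexp y : nilpotent y -> coact (nilexp y) = nilexp (coact y).
Proof. exact: (nilexp_morph coact_lrmorphism). Qed.

Lemma coact_Q : coact Q = leg13 Rz * leg12 (tmap f g Q).
Proof.
have [_ _ _ hex] := hR.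
rewrite /coact (_ : tmap _ _ Q = tlift (fun a c => tpure a (comul hH c)) Q) // hex.
by rewrite rmorphM /= tmap_leg13 tmap_leg12 (tmap_Q0 (g := h)) //; right.
Qed.
End Hexagon.

Lemma L_sq l : alpha l != 0 -> L l * L l = 1.
Proof.
move=> al.
have [f0 f0K f0X] := projection pred0.
have [f fK fX] := projection (pred1 (Z (l, false))).
have [g gK gX] := projection (pred1 (Z (l, true))).
(* With f keeping only Z_l^- and g only Z_l^+, just this term survives. Its second factor is Z_l^+,
   whose grouplike element is L_l, so the third leg becomes L_l^2. *)
set i0 := (l, false).
have fg_tau i : i != i0 -> tmap f g (tau i) = 0.
  move=> ii0; apply: tmap_tau0; rewrite fX gX /= !(inj_eq Z_inj).
  case: i ii0 => l' [] /=; last by rewrite /i0 => /negPf->; left.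
  by rewrite xpair_eqE andbF; left.
have fg_tau0 : tmap f g (tau i0) = tau i0.
  by rewrite tmapE /= rmorphM /= (morph_kpow _ gK) fX gX /= !eqxx.
(* The hexagon identity with every nilpotent generator killed in all three legs. *)
have c0 : coact f g f0 Rz = leg13 Rz * leg12 Rz.
  rewrite (coact_Rz fK gK f0K) -(coact_Rz f0K f0K f0K).
  have := coact_Q f0 f0K f0K f0X; rewrite (tmap_Q0 f0K f0K); last by left.
  rewrite coactM coact_nilexp ?nil_partE ?coact_sum; last first.
    by rewrite -nil_partE; exact: nil_part_nilpotent.
  rewrite big1 ?nilexp0 ?mulr1 // => i _.
  by rewrite coact_tau // tmap_tau0 ?tpure0l ?scaler0 //; left.
have sq0 (A : falgType F) (a : A) k : a ^+ 2 = 0 -> nilexp (k *: a) = 1 + k *: a.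
  by move=> a2; rewrite nilexp_sq0 // exprZn a2 scaler0.
have := coact_Q g fK f0K f0X.
rewrite (tmap_Q fK gK) (bigD1 i0) //= big1 ?addr0; last first.
  by move=> i ii0; rewrite fg_tau // scaler0.
rewrite fg_tau0 sq0 ?tau_sq // leg12M mulrA -c0 coactM coact_nilexp; last exact: nil_part_nilpotent.
rewrite nil_partE coact_sum (bigD1 i0) //= big1 ?addr0; last first.
  by move=> i ii0; rewrite coact_tau // fg_tau // tpure0l scaler0.
rewrite coact_tau // fg_tau0 sq0; last by rewrite expr2 tpureM -expr2 tau_sq tpure0l.
have uc : coact f g f0 Rz \is a GRing.unit.
  apply/unitrP; have [y [y1 y2]] := unitrP Rz_unit; exists (coact f g f0 y).
  by rewrite -!coactM y1 y2 /coact !rmorph1.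
(* Cancelling the R_z parts and the summand 1 leaves tau (x) L_l^2 = tau (x) 1 up to a nonzero
   scalar, with tau nonzero. *)
move/(mulrI uc); rewrite /leg12 tpureDl tpureZl => /addrI.
have c0' : cf i0 != 0 by rewrite /cf /= oppr_eq0.
move/(can_inj (scalerK c0')) => /eqP; rewrite -subr_eq0 -tpureNr -tpureDr => /eqP tz.
apply/eqP; rewrite -subr_eq0; apply: contraTT isT => L1.
have tau0 : tau i0 != 0.
  apply: tpure_neq0; first exact: XZ_neq0.
  by rewrite /L /= mulrI_eq0 ?XZ_neq0 //; apply/mulrI/(kpow_unit m_gt0 hA).
by have := tpure_neq0 tau0 L1; rewrite tz eqxx.
Qed.

(** * The monodromy as the square of an exponential *)

Lemma Rz_kpow v v' : Rz * tpure (kpow v) (kpow v') = tpure (kpow v) (kpow v') * Rz.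
Proof.
rewrite RzE mulr_suml mulr_sumr; apply: eq_bigr => i _.
rewrite -scalerAl -scalerAr !tpureM.
by rewrite (kpow_comm _ v : _ = _) (kpow_comm _ v' : _ = _).
Qed.

Lemma kpow0 : kpow 0 = 1.
Proof. by rewrite /torus_pow big1 // => a _; rewrite mxE expr0z. Qed.

Lemma kpow_Z i : alpha i.1 != 0 -> kpow (row (Z i) u) = L i.1.
Proof.
case: i => l [] //= /L_sq L2; rewrite Z_opp -/(L l).
by apply: (mulrI (kpow_unit m_gt0 hA _ : L l \is a GRing.unit)); rewrite divrr ?(kpow_unit m_gt0 hA).
Qed.

(** R_z passes X (x) 1, 1 (x) L and 1 (x) X' in turn, X' being the opposite generator. This leaves X
    L (x) L^2 X', where L^2 = 1, and the sign comes from X L = - L X. *)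
Lemma Rz_tau i : alpha i.1 != 0 ->
  Rz * tau i = - (tflip (tau (i.1, ~~ i.2)) * Rz).
Proof.
move=> al; set i' := (i.1, ~~ i.2).
have i'K : (i'.1, ~~ i'.2) = i by rewrite /= negbK -surjective_pairing.
rewrite /tau tflipE i'K /=; set g := L i.1.
have RZ1 : Rz * tpure (X (Z i)) 1 = tpure (X (Z i)) g * Rz.
  have -> : tpure (X (Z i)) 1 = tpure (X (Z i)) g * tpure 1 g :> tens H H.
    by rewrite tpureM mulr1 L_sq.
  have := Rz_X1 (Z i); rewrite kpow_Z // -/g => E.
  rewrite mulrA E -mulrA -kpow0 Rz_kpow mulrA tpureM kpow0 mulr1 mul1r.
  by [].
have R1Z : Rz * tpure 1 (X (Z i')) = tpure g (X (Z i')) * Rz.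
  by rewrite Rz_1X kpow_Z.
have -> : tpure (X (Z i)) (g * X (Z i')) = tpure (X (Z i)) 1 * (tpure 1 g * tpure 1 (X (Z i'))) :> tens H H.
  by rewrite !tpureM !mulr1 !mul1r.
rewrite mulrA RZ1 -mulrA (mulrA Rz) -kpow0 Rz_kpow kpow0 -(mulrA _ Rz) R1Z !mulrA !tpureM.
by rewrite mulr1 L_sq // mul1r -mulNr -tpureNl L_Z opprK.
Qed.

Lemma Rz_nil_part : Rz * x = tflip x * Rz.
Proof.
have swapK : involutive (fun i : 'I_t2 * bool => (i.1, ~~ i.2)).
  by case=> l e /=; rewrite negbK.
(* Exchanging Z_l^+ and Z_l^- changes the sign of the coefficient, which absorbs the sign in
   [Rz_tau]. *)
rewrite nil_partE mulr_sumr linear_sum mulr_suml (reindex_inj (inv_inj swapK)).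
apply: eq_bigr => i _; rewrite -scalerAr linearZ /= -scalerAl.
have [a0|a0] := eqVneq (alpha i.1) 0.
  by rewrite /cf /= a0 oppr0 !if_same !scale0r.
rewrite Rz_tau //= negbK -surjective_pairing scalerN -scaleNr; congr (_ *: _).
by rewrite /cf /=; case: i.2; rewrite ?opprK.
Qed.

Lemma monodromy : tflip Q * Q = nilexp x ^+ 2.
Proof.
have RR : tflip Rz * Rz = 1.
  by rewrite -[X in _ * X](tflipK Rz) -rmorphM /= Rz_flip rmorph1.
have nx := nil_part_nilpotent.
have nx' : nilpotent (tflip x) := nilpotent_morph (@tflip F H H) nx.
rewrite rmorphM /= (nilexp_morph (@tflip F H H) nx).
(* Thus R_z flipped carries exp(x_21) to exp(x) and then cancels against R_z. *)
have E : tflip Rz * tflip x = x * tflip Rz.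
  apply: (mulIr Rz_unit); rewrite -!mulrA -Rz_nil_part RR mulr1 mulrA.
  by rewrite RR mul1r.
by rewrite (nilexp_intertwine nx' nx E) -mulrA (mulrA (tflip Rz)) RR mul1r expr2.
Qed.

Lemma double_braid_nilexp (V W : hmod H) n (y : tens V W) :
  iter n (double_braid Q V W) y = tact (nilexp x ^+ (2 * n)) y.
Proof.
elim: n => [|n IH]; first by rewrite muln0 expr0 tact1.
by rewrite iterS IH double_braidE monodromy -tactM -exprD mulnS.
Qed.

Lemma tact_nilexp_id (V W : hmod H) (y : tens V W) :
  tact x y = 0 -> tact (nilexp x) y = y.
Proof.
move=> xy0; have [g _ ->] := nilexp_tail nil_part_nilpotent.
by rewrite !tactD tact1 expr2 !tactM xy0 !tact0r !addr0.
Qed.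

Lemma tact_nilexp_fixed (V W : hmod H) n (y : tens V W) :
  (0 < n)%N -> tact (nilexp x ^+ n) y = y -> tact x y = 0.
Proof.
move=> n0; have [g cgx ->] := nilexp_powers n nil_part_nilpotent.
rewrite !tactD tact1 -addrA -[RHS]addr0 => /addrI.
rewrite -scaler_nat tactZ => /eqP; rewrite addr_eq0 => /eqP E.
pose h := - (n%:R^-1) *: g.
have chx : GRing.comm h x by rewrite /GRing.comm -scalerAl cgx -scalerAr.
have E1 : tact x y = tact (h * x) (tact x y).
  apply: (can_inj (scalerK (F_char0 n0))); rewrite E -tactM -mulrA -expr2.
  by rewrite -scalerAl tactZ scalerA mulrN divff ?F_char0 // scaleN1r.
(* The fixed-point equation is iterated until the power of h x vanishes. *)
have E2 k : tact x y = tact ((h * x) ^+ k) (tact x y).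
  by elim: k => [|k IH]; rewrite ?expr0 ?tact1 // exprSr tactM -E1.
have [N xN] := nil_part_nilpotent.
by rewrite (E2 N) exprMn_comm // xN mulr0 tact0l.
Qed.

(** * The double braiding on the modules V and W *)

Section Ideals.
Variables (lam lam' : 'I_s -> F) (c c' : forall a, 'I_(m a) -> F).
Hypotheses (lam_unity : forall a, lam a ^+ m a = 1)
  (lam_unity' : forall a, lam' a ^+ m a = 1).
Hypotheses (cE : forall a (j : 'I_(m a)), c j * lam a ^+ j = 1)
  (cE' : forall a (j : 'I_(m a)), c' j * lam' a ^+ j = 1).
Variables r r' : 'I_t -> 'Z_2.

(** The element omega_p with free coefficients: for it, [lam a] is xi_a^(p_a) and the coefficients
    are the inverse powers of [lam a]. *)
Definition weight_idem (k : forall a, 'I_(m a) -> F) : H :=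
  \prod_a ((m a)%:R^-1 *: \sum_(j < m a) k a j *: K a ^+ j).
Local Notation om := weight_idem.
Local Notation V := (left_ideal_mod (xpow X r * om (@c))).
Local Notation W := (left_ideal_mod (xpow X r' * om (@c'))).

Lemma X_acts_zero k (q : 'I_t -> 'Z_2) (g : H)
    (v : left_ideal_mod (xpow X q * g)) : q k <> 0 -> hact (X k) v = 0.
Proof.
move=> /eqP qk; apply: val_inj; rewrite /= left_ideal_actE.
have /memv_cosetP[h _ ->] := subvsP v.
by rewrite (X_kills m_gt0 hA) // mulrA (X_xpow hA) ?mul0r.
Qed.

(** One clause for each term Z_l^e (x) L_l Z_l^(-e): its coefficient is zero, or its first factor
    kills V, or its second factor kills W. *)
Definition trivial_condition := forall (l : 'I_t2) (e : bool),
  alpha l = 0 \/ r (Z (l, e)) <> 0 \/ r' (Z (l, ~~ e)) <> 0.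

Lemma nil_part_acts_zero (y : tens V W) : trivial_condition -> tact x y = 0.
Proof.
move=> cond; rewrite nil_partE tact_suml big1 // => -[l e] _; rewrite tactZ.
have [al|[re|re]] := cond l e.
- by rewrite /cf /= al oppr0 if_same scale0r.
- by rewrite tact_vanish ?scaler0 //; left => v; apply: X_acts_zero.
- rewrite tact_vanish ?scaler0 //; right => v.
  by rewrite hactM X_acts_zero // -[hact _]/(left_ideal_act _) /left_ideal_act linear0 mulr0 linear0.
Qed.

Lemma not_trivial_condition : ~ trivial_condition ->
  exists l e, [/\ alpha l != 0, r (Z (l, e)) = 0 & r' (Z (l, ~~ e)) = 0].
Proof.
move=> ncond.
have [/existsP[l /existsP[e /and3P[al /eqP re /eqP re']]]|/existsPn h] :=
  boolP [exists l, exists e, [&& alpha l != 0, r (Z (l, e)) == 0 & r' (Z (l, ~~ e)) == 0]].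
  by exists l, e.
case: ncond => l e; have /existsPn/(_ e) := h l.
rewrite !negb_and negbK => /or3P[/eqP|/eqP|/eqP]; first by left.
  by right; left.
by right; right.
Qed.

Lemma nil_part_acts_nonzero l e : alpha l != 0 ->
  r (Z (l, e)) = 0 -> r' (Z (l, ~~ e)) = 0 -> exists y : tens V W, tact x y != 0.
Proof.
move=> al re re'.
have m0 a : (m a)%:R != 0 :> F by exact: F_char0.
have [phi phiE] := X_functional m_gt0 hA w_unity b_skew lam_unity cE m0 re.
have [psi psiE] := X_functional m_gt0 hA w_unity b_skew lam_unity' cE' m0 re'.
pose gen (g : H) : left_ideal_mod g := vsproj (left_ideal g) g.
have genE g : vsval (gen g) = g.
  by rewrite vsprojK // /left_ideal -[X in X \in _]mul1r memv_mul ?memvf ?memv_line.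
exists (tpure (gen _) (gen _)).
(* On the tensor product of the generators this form sees only the term (l, e) of the exponent:
   [phi] already annihilates all others, since Z is injective. *)
pose B (v : V) (w : W) : F^o := phi (vsval v) * psi (vsval w).
have bB : bilin B.
  split=> [v'|v'] k y1 y2; rewrite /B !linearP /=; first by rewrite mulrDl scalerAl.
  by rewrite mulrDr scalerAr.
apply/eqP => /(congr1 (tlift B)).
pose TB : {linear tens V W -> F^o} := HB.pack (tlift B)
   (GRing.isLinear.Build _ _ _ _ _ (@tlift_linear _ _ _ _ B)).
rewrite -[tlift B]/(TB : _ -> _) nil_partE tact_suml linear_sum linear0.
have termE i : TB (tact (cf i *: tau i) (tpure (gen _) (gen _)))
  = cf i * (phi (kpow 0 * X (Z i) * (xpow X r * om (@c)))
            * psi (L i.1 * X (Z (i.1, ~~ i.2)) * (xpow X r' * om (@c')))).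
  rewrite tactZ linearZ /= tactE tliftE // /B /= !left_ideal_actE !genE.
  by rewrite kpow0 mul1r.
rewrite (eq_bigr _ (fun i _ => termE i)) (bigD1 (l, e)) //= big1 ?addr0; last first.
  move=> i ile.
  have /eqP-> : phi (kpow 0 * X (Z i) * (xpow X r * om (@c))) == 0.
    by rewrite phiE (inj_eq Z_inj).
  by rewrite mul0r mulr0.
move/eqP; rewrite !mulf_eq0 phiE psiE !eqxx !orbF /cf /=.
by case: e {re re' phiE psiE termE}; rewrite ?oppr_eq0 (negPf al).
Qed.

Theorem double_braid_dichotomy :
  (double_braid Q V W =1 id <-> trivial_condition) /\
  (~ trivial_condition -> braid_infinite_order Q V W).
Proof.
have infinite : ~ trivial_condition -> braid_infinite_order Q V W.
  move=> /not_trivial_condition[l [e [al re re']]] n n0 braid_id.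
  have [y /eqP[]] := nil_part_acts_nonzero al re re'.
  apply: (@tact_nilexp_fixed _ _ (2 * n)); first by rewrite muln_gt0.
  by rewrite -double_braid_nilexp braid_id.
split=> //; split=> [braid_id|cond y].
  (* Infinite order with n = 1 says that the double braiding is not the identity. *)
  apply: boolp.contrapT => /infinite/(_ 1%N isT); apply.
  by move=> y; exact: braid_id.
rewrite -[LHS]/(iter 1 (double_braid Q V W) y) double_braid_nilexp.
rewrite muln1 expr2 tactM.
by rewrite !tact_nilexp_id // nil_part_acts_zero.
Qed.
End Ideals.

End Monodromy.

(** * Nenciu algebras *)

Lemma exprz_eqmod (A : unitRingType) (g : A) n (z z' : int) :
  g \is a GRing.unit -> g ^+ n = 1 -> (z = z' %[mod n])%Z -> g ^ z = g ^ z'.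
Proof.
move=> ug gn zz'; have gE k : g ^ k = g ^ (k %% n)%Z.
  by rewrite {1}(divz_eq k n) exprzDr // [(_ * _)%R in X in X * _ = _]mulrC -exprz_exp -exprnP gn exp1rz mul1r.
by rewrite gE zz' -gE.
Qed.

(** Exponents of K_a matter only modulo m_a, so generators of opposite type have inverse grouplike
    elements. *)
Lemma kpow_opp (F : fieldType) (H : falgType F) s (K : 'I_s -> H) (m : 'I_s -> nat)
    (v v' : 'rV[int]_s) :
  (forall a, K a \is a GRing.unit) -> (forall a b, K a * K b = K b * K a) ->
  (forall a, K a ^+ m a = 1) -> (forall a, v' ord0 a = - v ord0 a %[mod m a])%Z ->
  torus_pow K v' = (torus_pow K v)^-1.
Proof.
move=> uK cK Km v'v.
have uz a (z : int) : K a ^ z \is a GRing.unit by rewrite unitrXz.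
have cz a b (z z' : int) : GRing.comm (K a ^ z) (K b ^ z').
  by apply: commrXz; apply/commr_sym/commrXz; exact: cK.
have -> : torus_pow K v' = \prod_a (K a ^ v 0 a)^-1.
  by apply: eq_bigr => a _; rewrite (exprz_eqmod (uK a) (Km a) (v'v a)) -invr_expz.
rewrite /torus_pow; elim: (index_enum _) => [|a js IH]; first by rewrite !big_nil invr1.
have ujs : \prod_(j <- js) K j ^ v 0 j \is a GRing.unit by apply: rpred_prod => j _.
rewrite !big_cons IH -invrM //; congr (_^-1).
by apply: commr_sym; apply: commr_prod => j _; exact: cz.
Qed.

Section Specialisation.
Variables (R : realType) (s t : nat) (m : 'I_s -> nat).
Hypothesis hm : forall a, (0 < m a)%N.
Variables (d u : 'M[int]_(t, s)).
Local Notation C := (complex R).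

Lemma xipow_rowdot k l : xipow R m (rowdot (row k d) (row l u))
  = \prod_a (xi R (m a) ^ d k a) ^ u l a.
Proof. by apply: eq_bigr => a _; rewrite !mxE exprz_exp. Qed.

Lemma Rz_sum (H : falgType C) (K : 'I_s -> H) (z : 'M[int]_s) :
  Rz m K z = \sum_(i : Zm m * Zm m)
     ((\prod_a m a)%N%:R^-1 * xipow R m (- rowdot (Zrow i.1) (Zrow i.2))) *:
      tpure (torus_pow K (Zrow i.2)) (torus_pow K (Zrow i.1 *m z)).
Proof.
rewrite /Rz pair_big scaler_sumr; apply: eq_bigr => i _.
by rewrite scalerA.
Qed.
End Specialisation.

Theorem theorem5p30 (R : realType) (s t : nat) (hs : (0 < s)%N) (ht : (0 < t)%N)
  (m : 'I_s -> nat) (hm : forall a, (0 < m a)%N)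
  (d u : 'M[int]_(t, s)) (hdu : nenciu_matrices R m d u)
  (H : falgType (complex R)) (K : 'I_s -> H) (X : 'I_t -> H) (hH : hopf H)
  (hN : nenciu_hopf m K X d u hH)
  (t2 : nat) (Z : 'I_t2 * bool -> 'I_t) (hZ : opposite_pairs m X d u Z)
  (z : 'M[int]_s) (alpha : 'I_t2 -> complex R)
  (hz : Rz m K z * tflip (Rz m K z) = 1)
  (hR : is_Rmatrix hH (Rz m K z * Ralpha K X u Z alpha))
  (p q : Zm m) (r r' : 'I_t -> 'Z_2) :
  let Q := Rz m K z * Ralpha K X u Z alpha in
  let V := Vmod K X r p in
  let W := Vmod K X r' q in
  let cond := forall (l : 'I_t2) (e : bool),
    alpha l = 0 \/ r (Z (l, e)) <> 0 \/ r' (Z (l, ~~ e)) <> 0 in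
  (double_braid Q V W =1 id <-> cond) /\
  (~ cond -> braid_infinite_order Q V W).
Proof.
have [h1 h2] := hdu; have [hA hK hX] := hN; have [Zi Zopp Zanti _] := hZ.
pose w a k := xi R (m a) ^ d k a.
pose b k l := xipow R m (rowdot (row k d) (row l u)).
have char0 n : (0 < n)%N -> n%:R != 0 :> complex R by move=> n0; rewrite pnatr_eq0 -lt0n.
have w1 a k : w a k ^+ m a = 1 by exact: xi_exprz.
have bu k l : b k l = \prod_a w a k ^ u l a by exact: xipow_rowdot.
have hA' : skew_presented (F := complex R) m w b K X by exact: hA.
have cK a : comul hH (K a) = tpure (K a) (K a) by have [] := hK a.
have cX k : comul hH (X k) = tpure 1 (X k) + tpure (X k) (torus_pow K (row k u)).
  by have [] := hX k.
have uK a : K a \is a GRing.unit by exact: (K_unit hm hA').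
have Zop l : torus_pow K (row (Z (l, false)) u) = (torus_pow K (row (Z (l, true)) u))^-1.
  have [[Km KK _ _ _] _ _] := hA'.
  by apply: (kpow_opp uK KK Km) => a; rewrite !mxE; have [] := Zopp l a.
(* The character is the eigenvalue xi_a^(p_a) of K_a on omega_p. *)
have lam1 (p0 : Zm m) a : (xi R (m a) ^ (p0 a)%:Z) ^+ m a = 1 by exact: xi_exprz.
have cE (p0 : Zm m) a (j : 'I_(m a)) :
    xi R (m a) ^ (- (j%:Z * (p0 a)%:Z)) * (xi R (m a) ^ (p0 a)%:Z) ^+ j = 1.
  by rewrite [_ ^+ j]exprnP exprz_exp -expfzDr ?xi_neq0 // mulrC addNr expr0z.
exact: (double_braid_dichotomy char0 hm w1 h1 h2 bu hA' cK cX Zi Zanti Zop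
  (Rz_sum m K z) hz hR (lam1 p) (lam1 q) (cE p) (cE q) r r').
Qed.
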